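(* Fix $1<p<\infty$, let $q$ satisfy $\frac1p+\frac1q=1$, and let $n\ge1$. The following statements are equivalent. (i) For every asymmetric $L_p$-zonotope $Z\subset\mathbb{R}^n$ one has $|Z\oplus_p-Z|\le2^n|Z|$, with equality if and only if $Z$ is contained in a hyperplane or $Z$ is an $L_p$-sum of $n$ segments each having the origin as an endpoint. (ii) For every $m\ge n$ and every $n$-dimensional subspace $E$ of $\mathbb{R}^m$ one has $|P_EB_q^m|_n\le2^n|P_E(B_q^m\cap\mathbb{R}^m_+)|_n$, with equality if and only if there exists a partition $U_0,U_1,\dots,U_n$ of $[m]=\{1,\dots,m\}$ such that $U_j\ne\emptyset$ for every $1\le j\le n$, $U_0=\{i\in[m]:P_Ee_i=0\}$, and for every $1\le j\le n$ there exists a unit vector $w_j\in\sum_{i\in U_j}\mathbb{R}_{>0}\,e_i$ such that $E=\mathrm{span}(w_1,\dots,w_n)$.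
   Context: $|\cdot|$ and $|\cdot|_n$ denote $n$-dimensional Lebesgue measure; $h_K(x)=\sup_{k\in K}\langle x,k\rangle$. For compact convex sets $K,L$ containing the origin, $K\oplus_pL$ is the compact convex set with $h_{K\oplus_pL}=(h_K^p+h_L^p)^{1/p}$; $-Z=\{-z:z\in Z\}$ and $Z\oplus_p-Z$ means $Z\oplus_p(-Z)$. An asymmetric $L_p$-zonotope is an $L_p$-sum of finitely many segments containing the origin. $B_q^m=\{x\in\mathbb{R}^m:\sum_i|x_i|^q\le1\}$, $\mathbb{R}^m_+=\{x:x_i\ge0\ \forall i\}$, $e_1,\dots,e_m$ is the canonical basis of $\mathbb{R}^m$, $P_E$ is orthogonal projection onto $E$. $\sum_{i\in U}\mathbb{R}_{>0}e_i$ is the set of vectors $\sum_{i\in U}\lambda_ie_i$ with all $\lambda_i>0$; $U_0$ may be empty; ''unit'' refers to the Euclidean norm. *)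

(* Defs.v *)
From HB Require Import structures.
From mathcomp Require Import all_boot all_order all_algebra.
From mathcomp Require Import all_classical all_reals all_analysis.

Set Implicit Arguments.
Unset Strict Implicit.
Unset Printing Implicit Defensive.

Import Order.TTheory GRing.Theory Num.Theory.
Import numFieldNormedType.Exports.

Local Open Scope classical_set_scope.
Local Open Scope ring_scope.

Section tuple_cons_measure.
Context d (T : measurableType d) (R : realType) (n : nat).

Definition tcons (x : T * n.-tuple T) : n.+1.-tuple T :=
  [tuple of x.1 :: x.2].

Definition cons_measure (m1 : set T -> \bar R) (m2 : set (n.-tuple T) -> \bar R)
  : set (n.+1.-tuple T) -> \bar R := pushforward (m1 \x m2)%E tcons.

Let tuncons (t : n.+1.-tuple T) : T * n.-tuple T :=
  (thead t, [tuple of behead t]).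

Let measurable_tcons : measurable_fun [set: T * n.-tuple T] tcons.
Proof. exact: (measurable_cons measurable_fst measurable_snd). Qed.

Let measurable_tuncons : measurable_fun [set: n.+1.-tuple T] tuncons.
Proof.
apply/measurable_fun_pairP; split => /=; first exact: measurable_tnth.
exact: measurable_behead.
Qed.

Let tconsK : cancel tcons tuncons.
Proof.
by move=> [x t]; rewrite /tcons /tuncons theadE; congr pair; exact/val_inj.
Qed.

Variables (m1 : {sigma_finite_measure set T -> \bar R})
  (m2 : {sigma_finite_measure set (n.-tuple T) -> \bar R}).

Let cons_measure0 : cons_measure m1 m2 set0 = 0%E.
Proof. by rewrite /cons_measure /pushforward preimage_set0 measure0. Qed.

Let cons_measure_ge0 A : (0 <= cons_measure m1 m2 A)%E.
Proof. exact: measure_ge0. Qed.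

Let cons_measure_sigma_additive : semi_sigma_additive (cons_measure m1 m2).
Proof.
move=> F mF tF mUF; rewrite /cons_measure /pushforward preimage_bigcup.
apply: measure_semi_sigma_additive.
- by move=> k; rewrite -[X in measurable X]setTI; exact: measurable_tcons.
- apply/trivIsetP => i j _ _ ij; rewrite -preimage_setI.
  by move/trivIsetP : tF => /(_ _ _ _ _ ij) ->//; rewrite preimage_set0.
- rewrite -preimage_bigcup -[X in measurable X]setTI.
  exact: measurable_tcons.
Qed.

HB.instance Definition _ := isMeasure.Build _ _ _ (cons_measure m1 m2)
  cons_measure0 cons_measure_ge0 cons_measure_sigma_additive.

Let cons_measure_sigma_finite : sigma_finite setT (cons_measure m1 m2).
Proof.
have /sigma_finiteP[F [TF ndF Foo]] := sigma_finiteT m1.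
have /sigma_finiteP[G [TG ndG Goo]] := sigma_finiteT m2.
have FT : setT = \bigcup_k (F k `*` G k).
  apply/esym; rewrite -subTset => -[x t] _.
  have [i _ Fx] : (\bigcup_k F k) x by rewrite -TF.
  have [j _ Gt] : (\bigcup_k G k) t by rewrite -TG.
  exists (maxn i j) => //; split.
  - by move: x Fx; exact/subsetPset/ndF/leq_maxl.
  - by move: t Gt; exact/subsetPset/ndG/leq_maxr.
exists (fun k => tuncons @^-1` (F k `*` G k)).
  by rewrite -preimage_bigcup -FT preimage_setT.
move=> k; have [mF Fk] := Foo k; have [mG Gk] := Goo k; split.
  by rewrite -[X in measurable X]setTI; apply: measurable_tuncons => //;
    exact: measurableX.
rewrite /cons_measure /pushforward -comp_preimage.
rewrite (_ : _ \o _ = id); last by apply/funext => x; exact: tconsK.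
by rewrite preimage_id product_measure1E// lte_mul_pinfty// ge0_fin_numE.
Qed.

HB.instance Definition _ := Measure_isSigmaFinite.Build _ _ _
  (cons_measure m1 m2) cons_measure_sigma_finite.

End tuple_cons_measure.

Section power_measure.
Context d (T : measurableType d) (R : realType).
Variable m : {sigma_finite_measure set T -> \bar R}.

Fixpoint power_measure n : {sigma_finite_measure set (n.-tuple T) -> \bar R} :=
  match n with
  | 0 => \d_[tuple]
  | k.+1 => cons_measure m (power_measure k)
  end.

End power_measure.

Section Euclidean.
Context {R : realType}.

Definition dot n (u v : 'rV[R]_n) : R := \sum_(i < n) u 0 i * v 0 i.

(* The library norm `|u| on 'rV[R]_n is the sup norm, hence this definition. *)
Definition enorm n (u : 'rV[R]_n) : R := Num.sqrt (dot u u).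

Definition in_hyperplane n (A : set 'rV[R]_n) : Prop :=
  exists (u : 'rV[R]_n) (c : R), u != 0 /\ A `<=` [set x | dot u x = c].

(* The library has the Lebesgue measure on R only; [power_measure] carries its
   n-fold product to n-tuples, and the row vectors are identified with these. *)
Definition lebesgue_rV n (A : set 'rV[R]_n) : \bar R :=
  power_measure (@lebesgue_measure R) n
    [set t | A (\row_(i < n) (tnth t i : R))].

Definition orthonormal_basis m (E : {vspace 'rV[R]_m})
    (u : (\dim E).-tuple 'rV[R]_m) : Prop :=
  basis_of E u /\ forall i j, dot (tnth u i) (tnth u j) = (i == j)%:R.

(* The \dim E-dimensional Lebesgue measure of A `<=` E: the coordinates in an
   orthonormal basis identify E isometrically with R^(\dim E). By rotation
   invariance the value does not depend on the basis that [xget] picks. *)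
Definition lebesgue_vspace m (E : {vspace 'rV[R]_m}) (A : set 'rV[R]_m)
    : \bar R :=
  let u := xget (nseq_tuple (\dim E) 0)
    [set u | orthonormal_basis (E := E) u] in
  lebesgue_rV [set x : 'rV[R]_(\dim E) |
    A (\sum_(i < \dim E) x 0 i *: tnth u i)].

(* The element of E singled out by [get] exists and is unique. *)
Definition orth_proj m (E : {vspace 'rV[R]_m}) (x : 'rV[R]_m) : 'rV[R]_m :=
  get [set y | y \in E /\ forall e, e \in E -> dot (x - y) e = 0].

End Euclidean.

Section Lp_sums.
Context {R : realType}.

Definition support_fun n (K : set 'rV[R]_n) (x : 'rV[R]_n) : R :=
  sup [set dot x k | k in K].

(* For compact convex K and L containing the origin there is exactly one such M.
   Nonemptiness is explicit because the real-valued [sup] of set0 is 0, so that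
   set0 and [set 0] have the same [support_fun]. *)
Definition Lp_sum n (p : R) (K L : set 'rV[R]_n) : set 'rV[R]_n :=
  xget set0 [set M : set 'rV[R]_n | [/\ M !=set0, compact M, convex_set M &
    forall x, support_fun M x =
      (support_fun K x `^ p + support_fun L x `^ p) `^ (1 / p)]].

(* [set 0] is neutral for [Lp_sum p]. *)
Definition Lp_bigsum n (p : R) k (S : 'I_k -> set 'rV[R]_n) : set 'rV[R]_n :=
  \big[Lp_sum p/[set 0]]_(i < k) S i.

Definition segment n (a b : 'rV[R]_n) : set 'rV[R]_n :=
  [set (1 - t) *: a + t *: b | t in `[0, 1]].

Definition asymmetric_Lp_zonotope n (p : R) (Z : set 'rV[R]_n) : Prop :=
  exists k (a b : 'I_k -> 'rV[R]_n),
    (forall i, segment (a i) (b i) 0) /\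
    Z = Lp_bigsum p (fun i => segment (a i) (b i)).

End Lp_sums.

Section coordinates.
Context {R : realType}.

Definition lq_ball {m} (q : R) : set 'rV[R]_m :=
  [set x | \sum_(i < m) `|x 0 i| `^ q <= 1].

Definition orthant {m} : set 'rV[R]_m := [set x | forall i, 0 <= x 0 i].

Definition open_cone m (U : {set 'I_m}) : set 'rV[R]_m :=
  [set x | exists2 c : 'I_m -> R, (forall i, i \in U -> 0 < c i) &
    x = \sum_(i in U) c i *: delta_mx 0 i].

End coordinates.

Definition partition_family m k (U : 'I_k -> {set 'I_m}) : Prop :=
  forall i : 'I_m, exists! j : 'I_k, i \in U j.

(* Main.v *)
Require Import Defs.
From HB Require Import structures.
From mathcomp Require Import all_boot all_order all_algebra.
From mathcomp Require Import all_classical all_reals all_analysis.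
From mathcomp Require Import measurable_realfun ring lra.

Set Implicit Arguments.
Unset Strict Implicit.
Unset Printing Implicit Defensive.

Import Order.TTheory GRing.Theory Num.Theory.
Import numFieldNormedType.Exports.

Local Open Scope classical_set_scope.
Local Open Scope ring_scope.

(** Let T be an m x n matrix with rows v_1, ..., v_m, seen as the linear map from
    R^m to R^n with e_i |-> v_i. By Hölder's inequality and its equality case, the
    support function of the image of the nonnegative part of the l_q ball is
      x |-> (sum_i max(0, <v_i, x>)^p)^(1/p),
    so that this image is the L_p-sum of the segments [0, v_i]
    ([support_zonotope]). A segment through 0 with endpoints a and b is the
    L_p-sum of [0, a] and [0, b] ([segment_zonotope]), hence the asymmetric
    L_p-zonotopes are exactly these images Z ([asymmetric_Lp_zonotopeE],
    [zonotope_asymmetric]). Likewise the L_p-sum of Z and - Z is the image of the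
    whole l_q ball ([Lp_sum_zonotope], [lq_ball_zonotope]). All this uses that a
    compact convex set is determined by its support function
    ([support_fun_inj]).

    If the columns of T are an orthonormal basis of E, these images are the
    projections onto E of the ball and of its nonnegative part, read in
    orthonormal coordinates: (ii) is (i) for the matrices with orthonormal columns
    ([frame_bound]). If T is not of rank n, then Z lies in a hyperplane and both
    volumes vanish ([hyperplane_null]). Every T of rank n is T' S, where T' has
    orthonormal columns and S is invertible ([factor_through_frame]), and S
    multiplies all volumes by the same factor ([lebesgue_rV_mulmx]), which leaves
    the inequality and its equality case unchanged. That factor is obtained
    without determinants, from Fubini's theorem and the invariance of Lebesgue
    measure under translations, as in the proof that a Haar measure is unique up
    to a factor ([lebesgue_rV_exchange]).

    There remains to match the equality cases for a T with orthonormal columns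
    spanning E: Z is an L_p-sum of n segments [0, y_j] if and only if E is spanned
    by unit vectors in the open cones of n disjoint sets of coordinates. If Z is
    such a sum, the y_j form a basis, and in this basis
      sum_i max(0, <v_i, z>)^p = sum_j max(0, z_j)^p for all z.
    Evaluated at - e_j, at e_j and at (1, ..., 1), this identity leaves room only
    for v_i that are nonnegative multiples of a single y_j, because
    sum_j c_j^p < (sum_j c_j)^p as soon as two of the numbers c_j >= 0 are not 0
    ([support_pow_eq_id]). The set U_j then consists of the i such that v_i is a
    positive multiple of y_j ([zonotope_simplex_cones]). Conversely, the v_i with
    i in U_j are positive multiples of one vector, and the corresponding segments
    add up to one segment ([support_pow_disjoint], [cones_zonotope_simplex]). *)

(** * Lebesgue measure, translations and linear maps *)

Lemma mule_injl (R : realType) (z x y : \bar R) : z \is a fin_num -> (0 < z)%E ->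
  (z * x = z * y)%E -> x = y.
Proof.
by move=> zf z0 xy; apply/le_anti;
  rewrite -(lee_pmul2l zf z0 x y) -(lee_pmul2l zf z0 y x) xy lexx.
Qed.

Section LebesgueMeasure.
Context {R : realType}.
Local Notation T := (measurableTypeR R).
Local Notation L := (@lebesgue_measure R).
Local Notation mu := (power_measure L).

Definition row_of_tuple n (t : n.-tuple T) : 'rV[R]_n :=
  \row_(i < n) (tnth t i : R).

Definition tuple_of_row n (x : 'rV[R]_n) : n.-tuple T :=
  [tuple (x 0 i : T) | i < n].

Lemma tuple_of_rowK n : cancel (@tuple_of_row n) (@row_of_tuple n).
Proof. by move=> x; apply/rowP => i; rewrite mxE tnth_mktuple. Qed.

Lemma row_of_tupleK n : cancel (@row_of_tuple n) (@tuple_of_row n).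
Proof. by move=> t; apply: eq_from_tnth => i; rewrite tnth_mktuple mxE. Qed.

(** [lebesgue_rV] is a measure on this sigma-algebra, which is transported from
    the tuples. *)
Definition measurable_rV n (A : set 'rV[R]_n) :=
  measurable (@row_of_tuple n @^-1` A).

Lemma lebesgue_measure_shift (a : R) (A : set T) : measurable A ->
  pushforward L (+%R a : T -> T) A = L A.
Proof.
move=> mA; have ma : measurable_fun setT (+%R a : T -> T).
  exact: measurable_funD.
pose f : {mfun T >-> T} := HB.pack (+%R a : T -> T) (isMeasurableFun.Build _ _ _ _ _ ma).
apply/esym.
apply: (@lebesgue_measure_unique R (pushforward L f)) => // _ [[x y]] _ <-.
rewrite /pushforward/= [X in _ = L X](_ : _ = [set` `]x - a, y - a]]); last first.
  by apply/seteqP; split => z/=; rewrite !in_itv/= ltrBlDl lerBrDl.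
rewrite !lebesgue_measure_itv/= !lte_fin.
by rewrite ltrD2r; case: ifP => // _; congr (_%:E); rewrite opprB addrA subrK.
Qed.

Definition tuple_add n (a t : n.-tuple T) : n.-tuple T :=
  [tuple (tnth a i + tnth t i : R) | i < n].

Lemma power_measureS n (A : set (n.+1.-tuple T)) :
  mu n.+1 A = (\int[L]_x mu n [set t | A (tcons (x, t))])%E.
Proof.
rewrite /= /cons_measure /pushforward /product_measure1.
by apply: eq_integral => x _ /=; rewrite xsectionE.
Qed.

Lemma measurable_tcons n : measurable_fun setT (@tcons _ T n).
Proof. exact: (measurable_cons measurable_fst measurable_snd). Qed.

Lemma measurable_tcons_section n (A : set (n.+1.-tuple T)) x :
  measurable A -> measurable [set t | A (tcons (x, t))].
Proof.
move=> mA; rewrite [X in measurable X](_ : _ = xsection (@tcons _ T n @^-1` A) x).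
  apply: measurable_xsection; rewrite -[X in measurable X]setTI.
  exact: measurable_tcons.
by rewrite xsectionE.
Qed.

Lemma measurable_fun_tcons_section n (A : set (n.+1.-tuple T)) :
  measurable A -> measurable_fun setT (fun x => mu n [set t | A (tcons (x, t))]).
Proof.
move=> mA; rewrite [X in measurable_fun _ X](_ : _ =
    mu n \o xsection (@tcons _ T n @^-1` A)).
  apply: measurable_fun_xsection; rewrite -[X in measurable X]setTI.
  exact: measurable_tcons.
by apply/funext => x /=; rewrite xsectionE.
Qed.

(** By slicing along the first coordinate, since a translation permutes the slices
    and translates each of them. *)
Lemma power_measure_shift n (a : n.-tuple T) (A : set (n.-tuple T)) :
  measurable A -> mu n (tuple_add a @^-1` A) = mu n A.
Proof.
elim: n a A => [|n IH] a A mA.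
  by congr (mu 0%N _); apply/seteqP; split => t /=; 
    rewrite [tuple_add _ _]tuple0 [t]tuple0.
rewrite !power_measureS.
pose phi x := mu n [set t | A (tcons (x, t))].
have mphi : measurable_fun setT phi by exact: measurable_fun_tcons_section.
pose sh : T -> T := +%R (thead a).
transitivity (\int[L]_x phi (sh x))%E.
  apply: eq_integral => x _.
  rewrite /phi -[RHS](IH [tuple of behead a])//; last exact: measurable_tcons_section.
  congr (mu n _); apply/seteqP.
  suff tE t : tuple_add a (tcons (x, t)) =
    tcons (sh x, tuple_add [tuple of behead a] t).
    by split => t /=; rewrite tE.
  apply: eq_from_tnth => i; rewrite tnth_mktuple.
  have [->|[j ->]] : i = ord0 \/ exists j, i = lift ord0 j.
    by case: (unliftP ord0 i) => [j ->|->]; [right; exists j|left].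
    by [].
  by rewrite !tnthS !tnth_mktuple; congr (_ + _); rewrite [a in LHS]tuple_eta tnthS.
have ma : measurable_fun setT sh by exact: measurable_funD.
rewrite -[RHS](@eq_measure_integral _ _ _ _ _ (pushforward L sh)); last first.
  by move=> B mB _; exact: lebesgue_measure_shift.
by rewrite ge0_integral_pushforward.
Qed.

Lemma integral_indic_cst d (S : measurableType d) (m : {measure set S -> \bar R})
    (C : set S) (c : \bar R) : measurable C -> (0 <= c)%E ->
  (\int[m]_x ((\1_C x)%:E * c) = m C * c)%E.
Proof.
move=> mC c0; rewrite ge0_integralZr// ?integral_indic ?setIT//.
exact/measurable_EFinP/measurable_indic.
Qed.

Lemma measurable_coord d (S : measurableType d) n (f : S -> n.-tuple T) i :
  measurable_fun setT f -> measurable_fun setT (fun s => row_of_tuple (f s) 0 i).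
Proof.
move=> mf; under eq_fun do rewrite mxE.
exact: (measurableT_comp (measurable_tnth i) mf).
Qed.

Lemma measurable_affine d (S : measurableType d) n (f g : S -> n.-tuple T)
    (M N : 'M[R]_n) :
  measurable_fun setT f -> measurable_fun setT g ->
  measurable_fun setT (fun s => tuple_of_row
    (row_of_tuple (f s) *m M + row_of_tuple (g s) *m N)).
Proof.
move=> mf mg; apply/measurable_fun_tnthP => i.
rewrite [X in measurable_fun _ X](_ : _ = fun s =>
    \sum_j row_of_tuple (f s) 0 j * M j i + \sum_j row_of_tuple (g s) 0 j * N j i).
  by apply: measurable_funD; apply: measurable_sum => j;
    apply: measurable_funM => //; exact: measurable_coord.
by apply/funext => s /=; rewrite tnth_mktuple !mxE.
Qed.

Lemma measurable_rV_affine d (S : measurableType d) n (f g : S -> n.-tuple T)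
    (M N : 'M[R]_n) (A : set 'rV[R]_n) :
  measurable_rV A -> measurable_fun setT f -> measurable_fun setT g ->
  measurable [set s | A (row_of_tuple (f s) *m M + row_of_tuple (g s) *m N)].
Proof.
move=> mA mf mg; have := measurable_affine M N mf mg measurableT mA.
rewrite setTI; congr measurable; apply/seteqP.
by split => s /=; rewrite tuple_of_rowK.
Qed.

Lemma measurable_rV_mulmx n (S : 'M[R]_n) (A : set 'rV[R]_n) :
  measurable_rV A -> measurable_rV [set x | A (x *m S)].
Proof.
move=> mA.
have := @measurable_rV_affine _ _ n (fun t : n.-tuple T => t) (fun t => t) S 0 A mA.
move=> /(_ (@measurable_id _ _ _) (@measurable_id _ _ _)).
by congr measurable; apply/seteqP; split => t /=; rewrite mulmx0 addr0.
Qed.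

Lemma le_lebesgue_rV n (A B : set 'rV[R]_n) :
  measurable_rV A -> measurable_rV B -> A `<=` B -> (lebesgue_rV A <= lebesgue_rV B)%E.
Proof.
move=> mA mB AB; apply: (@le_measure _ _ _ (mu n)); rewrite ?inE//.
by move=> t; exact: AB.
Qed.

Lemma lebesgue_rV_shift n (a : 'rV[R]_n) (A : set 'rV[R]_n) :
  measurable_rV A -> lebesgue_rV [set x | A (a + x)] = lebesgue_rV A.
Proof.
move=> mA; rewrite /lebesgue_rV -[RHS](power_measure_shift (tuple_of_row a))//.
congr (mu n _); apply/seteqP; split => t /=.
all: by congr A; apply/rowP => i; rewrite !mxE !tnth_mktuple.
Qed.

(** Both sides are the measure of the set of the pairs (x, y) such that x S lies in
    A and x S + y in B. Its slices at fixed x are translates of B. Its slices at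
    fixed y, translated by y S^-1, consist of the x such that x S lies in B and
    x S - y in A; regrouped by x, these pairs have translates of - A as slices. *)
Lemma lebesgue_rV_exchange n (S : 'M[R]_n) (A B : set 'rV[R]_n) :
  S \in unitmx -> measurable_rV A -> measurable_rV B ->
  (lebesgue_rV [set x | A (x *m S)] * lebesgue_rV B =
   lebesgue_rV [set x | B (x *m S)] * lebesgue_rV [set x | A (- x)%R])%E.
Proof.
move=> uS mA mB.
pose r := @row_of_tuple n.
pose E1 : set (n.-tuple T * n.-tuple T) :=
  [set z | A (r z.1 *m S) /\ B (r z.1 *m S + r z.2)].
pose E2 : set (n.-tuple T * n.-tuple T) :=
  [set z | A (r z.1 *m S - r z.2) /\ B (r z.1 *m S)].
have mE1 : measurable E1.
  apply: measurableI.
    have := @measurable_rV_affine _ _ n _ _ S 0 A mA measurable_fst measurable_snd.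
    by congr measurable; apply/seteqP; split => t /=; rewrite mulmx0 addr0.
  have := @measurable_rV_affine _ _ n _ _ S 1%:M B mB measurable_fst measurable_snd.
  by congr measurable; apply/seteqP; split => t /=; rewrite mulmx1.
have mE2 : measurable E2.
  apply: measurableI.
    have := @measurable_rV_affine _ _ n _ _ S (- 1%:M) A mA measurable_fst measurable_snd.
    by congr measurable; apply/seteqP; split => t /=; rewrite mulmxN mulmx1.
  have := @measurable_rV_affine _ _ n _ _ S 0 B mB measurable_fst measurable_snd.
  by congr measurable; apply/seteqP; split => t /=; rewrite mulmx0 addr0.
have swapE (E : set (n.-tuple T * n.-tuple T)) : measurable E ->
    (\int[mu n]_x mu n (xsection E x) = \int[mu n]_y mu n (ysection E y))%E.
  move=> mE; apply: (product_measure_unique (m' := (mu n \x^ mu n)%E)) => //= C D mC mD.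
  by rewrite product_measure2E.
have intE (C : set 'rV[R]_n) (c : \bar R) : measurable_rV C -> (0 <= c)%E ->
    (\int[mu n]_t ((\1_(r @^-1` C) t)%:E * c) = lebesgue_rV C * c)%E.
  by move=> mC c0; rewrite integral_indic_cst.
have mAN : measurable_rV [set x | A (- x)].
  have := measurable_rV_mulmx (- 1%:M) mA; congr measurable_rV; apply/seteqP.
  by split => x /=; rewrite mulmxN mulmx1.
transitivity (\int[mu n]_x mu n (xsection E1 x))%E.
  rewrite -intE ?measure_ge0//; last exact: measurable_rV_mulmx.
  apply: eq_integral => t _; rewrite indicE.
  have [/set_mem/= At|/negP At] := boolP (t \in _).
    rewrite mul1e -(lebesgue_rV_shift (r t *m S))//; congr (mu n _).
    by apply/seteqP; split => y /=; rewrite xsectionE //= => -[].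
  rewrite mul0e xsectionE (_ : _ @^-1` _ = set0) ?measure0//.
  by apply/seteqP; split => y //= -[At' _]; apply: At; exact/mem_set.
rewrite swapE//.
transitivity (\int[mu n]_y mu n (ysection E2 y))%E.
  apply: eq_integral => y _.
  pose C := [set x | A (x *m S - r y) /\ B (x *m S)].
  have CE : r @^-1` C = ysection E2 y by rewrite ysectionE.
  have mC : measurable_rV C by rewrite /measurable_rV -/r CE; exact: measurable_ysection.
  transitivity (lebesgue_rV C); last by rewrite -CE.
  rewrite -(lebesgue_rV_shift (r y *m invmx S))//; congr (mu n _).
  rewrite ysectionE; apply/seteqP; split => t /=;
    by rewrite /C /E1 /= mulmxDl mulmxKV// addrAC subrr add0r [X in B X]addrC.
rewrite -swapE// -intE ?measure_ge0//; last exact: measurable_rV_mulmx.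
apply: eq_integral => t _; rewrite indicE.
have [/set_mem/= Bt|/negP Bt] := boolP (t \in _).
  rewrite mul1e -[RHS](lebesgue_rV_shift (- (r t *m S)))//; congr (mu n _).
  by apply/seteqP; split => y /=; rewrite xsectionE /E2/= opprD opprK => // -[].
rewrite mul0e xsectionE (_ : _ @^-1` _ = set0) ?measure0//.
by apply/seteqP; split => y //= -[_ Bt']; apply: Bt; exact/mem_set.
Qed.

Definition cube n (k : nat) : set 'rV[R]_n := [set x | forall i, `|x 0 i| <= k%:R].

Lemma cubeE n k : lebesgue_rV (@cube n k) = ((2 * k)%:R ^+ n)%:E.
Proof.
rewrite /lebesgue_rV; elim: n => [|n IH].
  by rewrite /= diracE mem_set// => -[].
rewrite power_measureS.
pose I : set T := `[- k%:R, k%:R]%classic.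
transitivity (\int[L]_x ((\1_I x)%:E * ((2 * k)%:R ^+ n)%:E))%E.
  apply: eq_integral => x _; rewrite -IH indicE.
  have [/set_mem/= xI|/negP xI] := boolP (x \in I).
    rewrite mul1e; congr (mu n _); apply/seteqP; split => t /= tk i.
      by have := tk (lift ord0 i); rewrite !mxE tnthS.
    case: (unliftP ord0 i) => [j ->|->]; rewrite !mxE ?tnthS.
      by have := tk j; rewrite mxE.
    by move: xI; rewrite /I/= in_itv/= -ler_norml.
  rewrite mul0e (_ : [set _ | _] = set0) ?measure0//.
  apply/seteqP; split => t //= tk; apply: xI; apply/mem_set.
  by have := tk ord0; rewrite mxE /I/= in_itv/= -ler_norml.
rewrite integral_indic_cst ?lee_fin ?exprn_ge0 ?ler0n//; last exact: measurable_itv.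
have LI : lebesgue_measure I = (2 * k)%:R%:E.
  rewrite /I lebesgue_measure_itv/= lte_fin.
  case: ifPn => [_|]; first by rewrite -EFinD opprK natrM mulr_natl mulr2n.
  rewrite -leNgt => k0; have -> : k = 0%N; last by rewrite muln0.
  by apply/eqP; rewrite -leqn0 -(@ler_nat R); move: k0; rewrite lerNr; lra.
by rewrite [X in (X * _)%E](_ : _ = (2 * k)%:R%:E) ?[LHS]LI// -EFinM exprS.
Qed.

Lemma measurable_rV_box n (r : 'rV[R]_n) (e : R) :
  measurable_rV [set x | forall i, `|x 0 i - r 0 i| < e].
Proof.
rewrite /measurable_rV [X in measurable X](_ : _ = \big[setI/setT]_(i < n)
    ((fun t : n.-tuple T => row_of_tuple t 0 i) @^-1` ball (r 0 i) e)).
  apply: bigsetI_measurable => i _; rewrite -[X in measurable X]setTI.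
  apply: measurable_coord => //.
  exact: measurable_ball.
rewrite -bigcap_seq; apply/seteqP; split => t /= tr i.
  by move=> _; rewrite /ball/= distrC.
by rewrite distrC; apply: tr => /=; exact: mem_index_enum.
Qed.

(** An open set is the union of the boxes with rational center and radius 1/(k+1)
    that it contains. *)
Lemma measurable_rV_open n (O : set 'rV[R]_n) : open O -> measurable_rV O.
Proof.
move=> oO.
pose box (z : 'rV[rat]_n * nat) : set 'rV[R]_n :=
  [set x | forall i, `|x 0 i - (map_mx ratr z.1 : 'rV[R]_n) 0 i| < z.2.+1%:R^-1].
have OE : O = \bigcup_z [set x | box z x /\ box z `<=` O].
  apply/seteqP; split => [x Ox|x [z _ [zx]]]; last exact.
  have := open_nbhs_nbhs (conj oO Ox) => /nbhs_ballP[e /= e0 eO].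
  have [k ke] : exists k, k.+1%:R^-1 < e / 2.
    have [k _ /(_ k (leqnn _))/= ke] := near_infty_natSinv_lt (PosNum (divr_gt0 e0 (@ltr0n R 2))).
    by exists k.
  pose d : R := k.+1%:R^-1; have d0 : 0 < d by rewrite invr_gt0.
  have /choice[r rP] : forall i, exists r : rat, `|x 0 i - ratr r| < d.
    move=> i; have /rat_in_itvoo[r] : x 0 i - d < x 0 i + d by lra.
    by rewrite in_itv/= => /andP[? ?]; exists r; rewrite ltr_norml; apply/andP; split; lra.
  exists (\row_i r i, k) => //; split; first by move=> i; rewrite !mxE/=; exact: rP.
  move=> y /= yr; apply: eO; split=> // i j; rewrite ord1 /ball/=.
  have := rP j; have := yr j; rewrite !mxE => h1 h2.
  move: h1 h2 ke; rewrite -/d !ltr_norml.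
  by move=> /andP[? ?] /andP[? ?] ?; apply/andP; split; lra.
rewrite /measurable_rV OE preimage_bigcup; apply: countable_bigcupT_measurable => // z.
have [zO|zO] := pselect (box z `<=` O).
  by have := measurable_rV_box (map_mx ratr z.1) z.2.+1%:R^-1;
    congr measurable; apply/seteqP; split => t //= -[].
by rewrite (_ : _ @^-1` _ = set0)//; apply/seteqP; split => t //= -[].
Qed.

Lemma measurable_rV_compact n (K : set 'rV[R]_n) : compact K -> measurable_rV K.
Proof.
move=> cK; have := closed_openC (compact_closed (@norm_hausdorff _ _) cK).
by move=> /measurable_rV_open /measurableC; rewrite /measurable_rV -preimage_setC setCK.
Qed.

Lemma compact_cube n k : compact (@cube n k).
Proof.
rewrite (_ : cube k = [set v : 'rV[R]_n | forall i, `[- k%:R, k%:R]%classic (v ord0 i)]).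
  apply: (@rV_compact R n (fun=> `[- k%:R, k%:R]%classic)) => i.
  exact: segment_compact.
by apply/seteqP; split => x /= h i; have := h i; rewrite in_itv/= ler_norml.
Qed.

(** In [lebesgue_rV_exchange], S = 1 shows that A and - A have the same measure,
    and the cube [-1, 1]^n as B then gives the factor: it is the ratio of the
    measures of the preimage of this cube and of the cube. It is not 0, as otherwise
    the whole space, which is its own preimage, would have measure 0. *)
Lemma lebesgue_rV_mulmx n (S : 'M[R]_n) : S \in unitmx ->
  exists2 c : R, 0 < c & forall A : set 'rV[R]_n, measurable_rV A ->
    lebesgue_rV [set x | A (x *m S)] = (c%:E * lebesgue_rV A)%E.
Proof.
move=> uS; have mQ := measurable_rV_compact (@compact_cube n 1).
have Q_neq0 : lebesgue_rV (@cube n 1) != 0%E.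
  by rewrite cubeE eqe expf_neq0// pnatr_eq0.
have Q_gt0 : (0 < lebesgue_rV (@cube n 1))%E by rewrite lt0e Q_neq0 measure_ge0.
have Q_fin : lebesgue_rV (@cube n 1) \is a fin_num by rewrite cubeE.
pose cQ := lebesgue_rV [set x | @cube n 1 (x *m S)].
have mcQ := measurable_rV_mulmx S mQ.
have cQ_fin : cQ \is a fin_num.
  have [k Qk] : exists k, [set x : 'rV[R]_n | cube 1 (x *m S)] `<=` cube k.
    (* If all |(x S)_j| <= 1, the entries of S^-1 bound those of x. *)
    pose s := \sum_i \sum_j `|invmx S i j|.
    have s0 : 0 <= s by apply: sumr_ge0 => i _; apply: sumr_ge0.
    exists (Num.truncn s).+1 => x /= Qx i; rewrite -(mulmxK uS x) mxE.
    apply: le_trans (ler_norm_sum _ _ _) _.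
    apply: (@le_trans _ _ s); last by rewrite ltW// truncnS_gt.
    apply: ler_sum => j _; rewrite normrM.
    apply: (@le_trans _ _ (1 * `|invmx S j i|)); first by rewrite ler_wpM2r.
    by rewrite mul1r (bigD1 i)//= lerDl sumr_ge0.
  rewrite ge0_fin_numE ?measure_ge0//.
  apply: le_lt_trans (_ : lebesgue_rV (@cube n k) < _)%E; last by rewrite cubeE ltry.
  exact: le_lebesgue_rV mcQ (measurable_rV_compact (@compact_cube n k)) Qk.
have lebesgueN (A : set 'rV[R]_n) : measurable_rV A ->
    lebesgue_rV [set x | A (- x)%R] = lebesgue_rV A.
  move=> mA; have := lebesgue_rV_exchange (unitmx1 R n) mA mQ.
  under eq_set do rewrite mulmx1.
  under [in RHS]eq_set do rewrite mulmx1.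
  by rewrite muleC => /(mule_injl Q_fin Q_gt0).
have key (A : set 'rV[R]_n) : measurable_rV A ->
    (lebesgue_rV [set x | A (x *m S)] * lebesgue_rV (@cube n 1) = cQ * lebesgue_rV A)%E.
  by move=> mA; rewrite (lebesgue_rV_exchange uS mA mQ) lebesgueN.
pose c := fine cQ / 2 ^+ n.
have EA (A : set 'rV[R]_n) : measurable_rV A ->
    lebesgue_rV [set x | A (x *m S)] = (c%:E * lebesgue_rV A)%E.
  move=> mA; apply: (mule_injl Q_fin Q_gt0).
  rewrite muleC key// muleA; congr (_ * _)%E.
  by rewrite cubeE muln1 -EFinM mulrCA divff ?mulr1 ?fineK// expf_neq0.
exists c => //.
rewrite lt_neqAle divr_ge0 ?exprn_ge0// ?fine_ge0 ?measure_ge0// andbT.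
apply/negP => /eqP c0; have := EA setT measurableT.
rewrite -c0 mul0e => T0.
have : (lebesgue_rV (@cube n 1) <= 0)%E.
  by rewrite -T0; apply: le_lebesgue_rV => //; exact: measurableT.
by rewrite leNgt Q_gt0.
Qed.

(** By induction on n: the slices along the first coordinate lie in hyperplanes of
    R^n, unless u is a multiple of the first basis vector; in that case all slices
    but one are empty. *)
Lemma hyperplane_null n (u : 'rV[R]_n) (a : R) (A : set 'rV[R]_n) :
  u != 0 -> measurable_rV A -> A `<=` [set x | dot u x = a] -> lebesgue_rV A = 0%E.
Proof.
elim: n u a A => [|n IH] u a A; first by rewrite [u]thinmx0 eqxx.
move=> u0 mA Aa; rewrite /lebesgue_rV power_measureS.
pose v := \row_i u 0 (lift ord0 i).
have dotE x t : dot u (row_of_tuple (tcons (x, t))) =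
    u 0 ord0 * x + dot v (@row_of_tuple n t).
  rewrite /dot big_ord_recl mxE; congr (_ + _).
  by apply: eq_bigr => i _; rewrite !mxE tnthS.
have mAx x :
    measurable_rV [set y : 'rV[R]_n | A (row_of_tuple (tcons (x, tuple_of_row y)))].
  have := measurable_tcons_section x mA; congr measurable; apply/seteqP.
  by split => t /=; rewrite row_of_tupleK.
have AxE x : mu n [set t | A (row_of_tuple (tcons (x, t)))] =
    lebesgue_rV [set y : 'rV[R]_n | A (row_of_tuple (tcons (x, tuple_of_row y)))].
  by congr (mu n _); apply/seteqP; split => t /=; rewrite row_of_tupleK.
have [v0|v0] := eqVneq v 0.
  have u00 : u 0 ord0 != 0.
    apply: contra u0 => /eqP u00; apply/eqP/rowP => i; rewrite mxE.
    case: (unliftP ord0 i) => [j ->|->//].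
    by move/rowP/(_ j): v0; rewrite !mxE.
  pose b : T := a / u 0 ord0.
  pose phi x := mu n [set t | A (row_of_tuple (tcons (x, t)))].
  have phiE x : phi x = ((\1_[set b] x)%:E * phi b)%E.
    rewrite indicE; have [/set_mem/= ->|/negP xb] := boolP (x \in _).
      by rewrite mul1e.
    rewrite mul0e /phi (_ : [set _ | _] = set0) ?measure0//.
    apply/seteqP; split => t //= /Aa /=; rewrite dotE v0 => xa.
    apply: xb; apply/mem_set; rewrite /= /b -xa /dot big1 => [|i _].
      by rewrite addr0 mulrAC divff// mul1r.
    by rewrite mxE mul0r.
  transitivity (\int[L]_x ((\1_[set b] x)%:E * phi b))%E.
    by apply: eq_integral => x _; exact: phiE.
  have pb : (0 <= phi b)%E by exact: measure_ge0.
  have mb : measurable [set b] by exact: measurable_set1.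
  rewrite (integral_indic_cst _ mb pb).
  by rewrite [X in (X * _)%E](_ : _ = 0%E) ?mul0e//; exact: lebesgue_measure_set1.
rewrite integral0_eq// => x _.
change (mu n [set t | A (row_of_tuple (tcons (x, t)))] = 0%E).
rewrite AxE; apply: (IH v (a - u 0 ord0 * x)) => // y /= /Aa /=.
by rewrite dotE tuple_of_rowK => <-; rewrite addrAC subrr add0r.
Qed.
End LebesgueMeasure.
(** * Hölder's inequality for finite sums *)

Section FiniteHolder.
Context {R : realType}.

Definition conjugate_exponents (p q : R) := [/\ 1 < p, 1 < q & p^-1 + q^-1 = 1].

Lemma conjugate_exponentsP (p q : R) :
  1 < p -> 1 / p + 1 / q = 1 -> conjugate_exponents p q.
Proof.
move=> hp; rewrite !mul1r => pq.
have p0 : 0 < p by lra.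
have pV0 : 0 < p^-1 by rewrite invr_gt0.
have pV1 : p^-1 < 1 by rewrite invf_lt1.
have qV0 : 0 < q^-1 by lra.
have q0 : 0 < q by rewrite -invr_gt0.
by split => //; rewrite -invf_lt1//; lra.
Qed.

Lemma conjugate_exponentsC p q : conjugate_exponents p q -> conjugate_exponents q p.
Proof. by move=> [p1 q1 pq]; split=> //; rewrite addrC. Qed.

Lemma sum_powR_ge0 (p : R) m (a : 'I_m -> R) : 0 <= \sum_i a i `^ p.
Proof. by apply: sumr_ge0 => i _; exact: powR_ge0. Qed.

Lemma sum_powR_eq0 (p : R) m (a : 'I_m -> R) :
  \sum_i a i `^ p = 0 -> forall i, a i = 0.
Proof.
move=> /eqP; rewrite psumr_eq0; last by move=> i _; exact: powR_ge0.
by move=> /allP/(_ _ (mem_index_enum _)) h i; exact: powR_eq0_eq0 (eqP (h i)).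
Qed.

Lemma powR_le1 (x r : R) : 0 <= x -> x <= 1 -> 0 <= r -> x `^ r <= 1.
Proof.
move=> x0 x1 r0; have := @ge0_ler_powR R r r0 x 1.
by rewrite powR1; apply; rewrite ?nnegrE.
Qed.

Lemma powR_rootK (p x : R) : 1 < p -> 0 <= x -> (x `^ (1 / p)) `^ p = x.
Proof. by move=> p1 x0; rewrite -powRrM mul1r mulVf ?powRr1//; lra. Qed.

(** Young's inequality, summed over i after scaling a to p-norm 1. *)
Lemma holder_unit p q m (a y : 'I_m -> R) : conjugate_exponents p q ->
  (forall i, 0 <= a i) -> (forall i, 0 <= y i) -> \sum_i y i `^ q <= 1 ->
  \sum_i a i * y i <= (\sum_i a i `^ p) `^ (1 / p).
Proof.
move=> [p1 q1 pq] a0 y0 y1; have p0 : 0 < p by lra.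
have q0 : 0 < q by lra.
have [/sum_powR_eq0 aE|N0] := eqVneq (\sum_i a i `^ p) 0.
  by rewrite big1 ?powR_ge0// => i _; rewrite aE mul0r.
have {}N0 : 0 < \sum_i a i `^ p by rewrite lt_neqAle eq_sym N0 sum_powR_ge0.
set N := \sum_i a i `^ p in N0 *; set r := N `^ (1 / p).
have r0 : 0 < r by rewrite powR_gt0.
suff : \sum_i (a i / r) * y i <= 1.
  rewrite -(ler_pM2l r0) mulr1; apply: le_trans.
  rewrite mulr_sumr le_eqVlt; apply/orP; left; apply/eqP.
  by apply: eq_bigr => i _; rewrite mulrA [r * _]mulrC divfK// gt_eqF.
apply: (@le_trans _ _ (\sum_i ((a i / r) `^ p / p + y i `^ q / q))).
  by apply: ler_sum => i _; apply: conjugate_powR => //; rewrite divr_ge0// ltW.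
rewrite big_split/= -!mulr_suml.
have rp : r `^ p = N by exact: powR_rootK (ltW N0).
have -> : \sum_i (a i / r) `^ p = 1.
  under eq_bigr do rewrite powRM ?invr_ge0 ?(ltW r0)//.
  rewrite -mulr_suml -/N -[r^-1]powR_inv1 ?(ltW r0)// powRAC rp.
  by rewrite powR_inv1 ?(ltW N0)// divff ?gt_eqF.
by rewrite -[leRHS]pq mul1r lerD2l -[leRHS]mul1r ler_wpM2r// invr_ge0 ltW.
Qed.

Lemma holder_attained p q m (a : 'I_m -> R) : conjugate_exponents p q ->
  (forall i, 0 <= a i) ->
  exists y : 'I_m -> R, [/\ forall i, 0 <= y i, \sum_i y i `^ q <= 1,
    forall i, a i = 0 -> y i = 0 &
    \sum_i a i * y i = (\sum_i a i `^ p) `^ (1 / p)].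
Proof.
move=> [p1 q1 pq] a0; have p0 : 0 < p by lra.
have q0 : 0 < q by lra.
have [N0|N0] := eqVneq (\sum_i a i `^ p) 0.
  exists (fun=> 0); split=> //.
    by rewrite big1 ?ler01// => i _; rewrite powR0// gt_eqF.
  rewrite N0 big1; first by rewrite powR0// mul1r invr_eq0 gt_eqF.
  by move=> i _; rewrite mulr0.
have {}N0 : 0 < \sum_i a i `^ p by rewrite lt_neqAle eq_sym N0 sum_powR_ge0.
set N := \sum_i a i `^ p in N0 *.
have qp1 : (p - 1) * q = p.
  have : (p^-1 + q^-1) * (p * q) = p * q by rewrite pq mul1r.
  rewrite mulrDl mulrA mulVf ?gt_eqF// mul1r mulrCA mulVf ?gt_eqF// mulr1 => h.
  by rewrite mulrBl mul1r -h; lra.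
(* The equality case of Young's inequality, y_i^q = a_i^p / N. *)
exists (fun i => a i `^ (p - 1) / N `^ (1 / q)); split.
- by move=> i; rewrite divr_ge0 ?powR_ge0.
- under eq_bigr do rewrite powRM ?invr_ge0 ?powR_ge0// -powRrM qp1.
  rewrite -mulr_suml -/N -powR_inv1 ?powR_ge0// powRAC.
  by rewrite powR_rootK ?(ltW N0)// powR_inv1 ?(ltW N0)// divff ?gt_eqF.
- by move=> i ->; rewrite powR0 ?mul0r//; lra.
under eq_bigr do rewrite mulrA mulr_powRB1//.
rewrite -mulr_suml -/N -powRN -{1}[N]powRr1 ?(ltW N0)// -powRD; last
   by rewrite (gt_eqF N0) implybT.
by rewrite !mul1r -pq addrK.
Qed.

End FiniteHolder.

(** * Compact convex sets and their support functions *)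

Section ConvexBodies.
Context {R : realType}.

Lemma dotE n (u v : 'rV[R]_n) : dot u v = (u *m v^T) 0 0.
Proof. by rewrite mxE; apply: eq_bigr => i _; rewrite mxE. Qed.

Lemma dotC n (u v : 'rV[R]_n) : dot u v = dot v u.
Proof. by apply: eq_bigr => i _; rewrite mulrC. Qed.

Lemma dotDr n (u v w : 'rV[R]_n) : dot u (v + w) = dot u v + dot u w.
Proof. by rewrite !dotE linearD mulmxDr mxE. Qed.

Lemma dotZr n (u v : 'rV[R]_n) a : dot u (a *: v) = a * dot u v.
Proof. by rewrite !dotE linearZ -scalemxAr mxE. Qed.

Lemma dotNr n (u v : 'rV[R]_n) : dot u (- v) = - dot u v.
Proof. by rewrite -scaleN1r dotZr mulN1r. Qed.

Lemma dotDl n (u v w : 'rV[R]_n) : dot (v + w) u = dot v u + dot w u.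
Proof. by rewrite dotC dotDr ![dot u _]dotC. Qed.

Lemma dotZl n (u v : 'rV[R]_n) a : dot (a *: v) u = a * dot v u.
Proof. by rewrite dotC dotZr dotC. Qed.

Lemma dotNl n (u v : 'rV[R]_n) : dot (- v) u = - dot v u.
Proof. by rewrite dotC dotNr dotC. Qed.

Lemma dot_sub_scale n (u w : 'rV[R]_n) t :
  dot (u - t *: w) (u - t *: w) = dot u u - 2 * t * dot u w + t ^+ 2 * dot w w.
Proof.
rewrite dotDr !dotDl !(dotNr, dotNl, dotZl, dotZr) [dot w u]dotC; ring.
Qed.

Lemma dot_mulmx m n (T : 'M[R]_(m, n)) x y : dot x (y *m T) = dot (x *m T^T) y.
Proof. by rewrite !dotE trmx_mul mulmxA. Qed.

Lemma dot_ge0 n (u : 'rV[R]_n) : 0 <= dot u u.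
Proof. by apply: sumr_ge0 => i _; rewrite -expr2 sqr_ge0. Qed.

Lemma dot_eq0 n (u : 'rV[R]_n) : dot u u = 0 -> u = 0.
Proof.
move=> /eqP; rewrite psumr_eq0; last by move=> i _; rewrite -expr2 sqr_ge0.
move=> /allP/(_ _ (mem_index_enum _)) h; apply/rowP => i; rewrite mxE.
by apply/eqP; have := h i; rewrite /= mulf_eq0 orbb.
Qed.

Lemma continuous_mx (X : topologicalType) m n (f : X -> 'M[R]_(m, n)) :
  (forall i j, continuous (fun x => f x i j)) -> continuous f.
Proof.
move=> cf x A [P PM PA]; rewrite /nbhs/=.
have : \forall y \near x, forall ij : 'I_m * 'I_n, P ij.1 ij.2 (f y ij.1 ij.2).
  by apply: filter_forall => ij; exact: cf (PM _ _).
by apply: filterS => y Py; apply: PA => i j; exact: (Py (i, j)).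
Qed.

Lemma continuous_dot (X : topologicalType) n (f g : X -> 'rV[R]_n) :
  continuous f -> continuous g -> continuous (fun x => dot (f x) (g x)).
Proof.
move=> cf cg; apply: continuous_big; first exact: add_continuous.
move=> i _ x.
have cc (h : X -> 'rV[R]_n) : continuous h -> h y 0 i @[y --> x] --> h x 0 i.
  by move=> ch; apply: (continuous_comp (ch x) (@coord_continuous _ _ _ 0 i (h x))).
exact: cvgM (cc _ cf) (cc _ cg).
Qed.

Lemma continuous_mulmxr m n (T : 'M[R]_(m, n)) : continuous (fun y : 'rV[R]_m => y *m T).
Proof.
apply: continuous_mx => i j.
rewrite (_ : (fun _ => _) = fun y : 'rV[R]_m => dot y (row j T^T)).
  by apply: continuous_dot => x; [exact: cvg_id | exact: cst_continuous].
by apply/funext => y; rewrite mxE; apply: eq_bigr => k _; rewrite ord1 !mxE.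
Qed.

Lemma convex_setI01 n (A : set 'rV[R]_n) :
  (forall x y t, 0 <= t -> t <= 1 -> A x -> A y -> A (t *: x + (1 - t) *: y)) ->
  convex_set A.
Proof.
by move=> cA x y t /set_mem Ax /set_mem Ay; apply/mem_set; apply: cA.
Qed.

Lemma convex_setD n (A : set 'rV[R]_n) x y t : convex_set A ->
  0 <= t -> t <= 1 -> A x -> A y -> A (t *: x + (1 - t) *: y).
Proof.
move=> cA t0 t1 Ax Ay.
by have := cA x y (Itv01 t0 t1) (mem_set Ax) (mem_set Ay) => /set_mem.
Qed.

Lemma support_fun_ub n (K : set 'rV[R]_n) x k :
  compact K -> K k -> dot x k <= support_fun K x.
Proof.
move=> cK Kk; apply: ub_le_sup; last by exists k.
suff : compact (dot x @` K).
  by move=> cxK; case: (compact_has_sup _ cxK) => //; exists (dot x k), k.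
apply: continuous_compact => //; apply: continuous_subspaceT.
by apply: continuous_dot => y; [exact: cst_continuous|exact: cvg_id].
Qed.

(** With k0 the point of K nearest to x, the direction x - k0 separates: if k in K
    had <x - k0, k - k0> > 0, a small step from k0 towards k would come closer to
    x. *)
Lemma separation n (K : set 'rV[R]_n) x : K !=set0 -> compact K -> convex_set K ->
  ~ K x -> exists u, support_fun K u < dot u x.
Proof.
move=> K0 cK vK Kx.
pose f y := dot (x - y) (x - y).
have cf : continuous f.
  have c1 : continuous (fun y : 'rV[R]_n => x - y).
    by move=> y; apply: (@cvgB _ 'rV[R]_n _ (nbhs y) _ (fun=> x) id);
      [exact: cvg_cst|exact: cvg_id].
  exact: continuous_dot.
have [k0 /set_mem Kk0 k0min] := compact_EVT_min K0 cK (continuous_subspaceT cf).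
exists (x - k0); set u := x - k0.
have u0 : 0 < dot u u.
  rewrite lt_neqAle dot_ge0 andbT eq_sym; apply/eqP => /dot_eq0 /eqP.
  by rewrite subr_eq0 => /eqP xk; apply: Kx; rewrite xk.
have kP k : K k -> dot u (k - k0) <= 0.
  move=> Kk; set w := k - k0; rewrite leNgt; apply/negP => uw.
  have ft t : 0 <= t -> t <= 1 -> dot u u <= dot u u - 2 * t * dot u w + t ^+ 2 * dot w w.
    move=> t0 t1; have := k0min _ (mem_set (convex_setD vK t0 t1 Kk Kk0)).
    rewrite /f (_ : x - (t *: k + (1 - t) *: k0) = u - t *: w).
      by rewrite dot_sub_scale.
    by apply/rowP => i; rewrite !mxE; ring.
  have ww : 0 <= dot w w := dot_ge0 w.
  (* This step satisfies t <= 1 and t |w|^2 <= <u, w>. *)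
  pose t := dot u w / (dot u w + dot w w).
  have d0 : 0 < dot u w + dot w w by lra.
  have t0 : 0 < t by rewrite divr_gt0.
  have t1 : t <= 1 by rewrite ler_pdivrMr//; lra.
  have := ft t (ltW t0) t1.
  have tE : t * (dot u w + dot w w) = dot u w by rewrite divfK// gt_eqF.
  have : 0 < t * dot u w by rewrite mulr_gt0.
  have : 0 <= t * dot u w * t by rewrite mulr_ge0 ?ltW// mulr_gt0.
  have -> : t ^+ 2 * dot w w = t * (t * (dot u w + dot w w)) - t * dot u w * t by ring.
  by rewrite tE; nra.
apply: (@le_lt_trans _ _ (dot u k0)).
  apply: ge_sup; first by exists (dot u k0), k0.
  by move=> _ [k Kk <-]; have := kP k Kk; rewrite dotDr dotNr; lra.
by have : dot u x - dot u k0 = dot u u; [rewrite /u dotDr dotNr|lra].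
Qed.

(** A point of K outside M could be separated from M, against the equality of the
    support functions in the separating direction. *)
Lemma support_fun_inj n (K M : set 'rV[R]_n) :
  K !=set0 -> compact K -> convex_set K -> M !=set0 -> compact M -> convex_set M ->
  (forall x, support_fun K x = support_fun M x) -> K = M.
Proof.
suff sub (A B : set 'rV[R]_n) : A !=set0 -> compact A ->
    B !=set0 -> compact B -> convex_set B ->
    (forall x, support_fun A x = support_fun B x) -> A `<=` B.
  by move=> ? ? ? ? ? ? KM; apply/seteqP; split; apply: sub => //.
move=> A0 cA B0 cB vB AB x Ax; apply: contrapT => /(separation B0 cB vB)[u].
by rewrite -AB ltNge support_fun_ub.
Qed.

Lemma support_fun_max n (K : set 'rV[R]_n) x k :
  K k -> (forall y, K y -> dot x y <= dot x k) -> support_fun K x = dot x k.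
Proof.
move=> Kk kmax; apply/le_anti/andP; split.
  by apply: ge_sup; [exists (dot x k), k|move=> _ [y Ky <-]; exact: kmax].
by apply: ub_le_sup; [exists (dot x k) => _ [y Ky <-]; exact: kmax|exists k].
Qed.

Lemma Lp_sumE p n (K L M : set 'rV[R]_n) :
  M !=set0 -> compact M -> convex_set M ->
  (forall x, support_fun M x =
     (support_fun K x `^ p + support_fun L x `^ p) `^ (1 / p)) ->
  Lp_sum p K L = M.
Proof.
move=> M0 cM vM ME; rewrite /Lp_sum.
set S := [set M | _].
have [N0 cN vN NE] : S (xget set0 S) by apply: xgetPex; exists M.
by apply: support_fun_inj => // x; rewrite NE ME.
Qed.

End ConvexBodies.

(** * Zonotopes as linear images of the nonnegative part of the l_q ball *)

Section Zonotopes.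
Context {R : realType}.
Context (p q : R) (pq : conjugate_exponents p q).

(** With 1/p + 1/q = 1, this is the L_p-sum of the segments from 0 to the rows of
    T. As a linear image, it behaves well under matrix products and projections. *)
Definition zonotope m n (T : 'M[R]_(m, n)) : set 'rV[R]_n :=
  (fun y => y *m T) @` (lq_ball q `&` orthant).

(** The p-th power of the support function of [zonotope T]: it is additive in the
    rows of T. *)
Definition support_pow m n (T : 'M[R]_(m, n)) (x : 'rV[R]_n) : R :=
  \sum_i Num.max 0 ((x *m T^T) 0 i) `^ p.

(** By Hölder's inequality and its equality case. This presents the nonnegative part
    of the l_q ball as an intersection of half-spaces, hence closed and convex. *)
Lemma lq_orthant_dualP m (y : 'rV[R]_m) : orthant y ->
  (lq_ball q y <-> forall a : 'rV[R]_m, (forall i, 0 <= a 0 i) ->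
     \sum_i a 0 i `^ p <= 1 -> dot a y <= 1).
Proof.
have [p1 q1 _] := pq.
move=> y0; rewrite /lq_ball/=.
under eq_bigr do rewrite (ger0_norm (y0 _)).
split => [y1 a a0 a1|h].
  apply: le_trans (holder_unit pq a0 y0 y1) _.
  by apply: powR_le1; rewrite ?sum_powR_ge0// mul1r invr_ge0; lra.
have [a [a0 a1 _ aE]] := holder_attained (conjugate_exponentsC pq) y0.
have aE' : dot (\row_i a i) y = (\sum_i y 0 i `^ q) `^ (1 / q).
  by rewrite -aE; apply: eq_bigr => i _; rewrite mxE mulrC.
have := h (\row_i a i); rewrite aE' => h1.
rewrite -(powR_rootK q1 (sum_powR_ge0 _ _)).
apply: powR_le1; [exact: powR_ge0| |lra].
apply: h1; first by move=> i; rewrite mxE.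
by under eq_bigr do rewrite mxE.
Qed.

Lemma lq_orthantE m : lq_ball q `&` orthant =
  [set y : 'rV[R]_m | orthant y /\ forall a : 'rV[R]_m, (forall i, 0 <= a 0 i) ->
     \sum_i a 0 i `^ p <= 1 -> dot a y <= 1].
Proof.
by apply/seteqP; split => y /= [h1 h2]; split => //; apply/lq_orthant_dualP.
Qed.

Lemma convex_lq_orthant m : convex_set (lq_ball q `&` @orthant R m).
Proof.
rewrite lq_orthantE; apply: convex_setI01 => x y t t0 t1 [x0 x1] [y0 y1].
have s0 : 0 <= 1 - t by lra.
split; first by move=> i; rewrite !mxE addr_ge0// mulr_ge0.
move=> a a0 a1; rewrite dotDr !dotZr.
have := ler_wpM2l t0 (x1 a a0 a1); have := ler_wpM2l s0 (y1 a a0 a1); lra.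
Qed.

Lemma lq_coord_le1 m (y : 'rV[R]_m) i : lq_ball q y -> `|y 0 i| <= 1.
Proof.
have [p1 q1 _] := pq.
rewrite /lq_ball/= (bigD1 i)//= => h.
have : `|y 0 i| `^ q <= 1 `^ q.
  rewrite powR1; apply: le_trans h; rewrite lerDl.
  by apply: sumr_ge0 => j _; exact: powR_ge0.
rewrite leNgt => /negP y1; rewrite leNgt; apply/negP => y2; apply: y1.
by rewrite gt0_ltr_powR ?nnegrE//; lra.
Qed.

Lemma compact_lq_orthant m : compact (lq_ball q `&` @orthant R m).
Proof.
apply: (subclosed_compact _ (@compact_cube R m 1)); last first.
  by move=> y [y1 _] i; exact: lq_coord_le1.
rewrite lq_orthantE.
have cl (a : 'rV[R]_m) (c : R) : closed [set y | dot a y <= c].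
  apply: (@preimage_closed _ _ (dot a) [set x | x <= c]); last exact: closed_le.
  by move=> y _; apply: continuous_dot; [exact: cst_continuous|move=> z; exact: cvg_id].
rewrite (_ : [set _ | _] =
  \bigcap_(ac in [set ac : 'rV[R]_m * R | [set y | orthant y /\ forall a : 'rV[R]_m,
      (forall i, 0 <= a 0 i) -> \sum_i a 0 i `^ p <= 1 -> dot a y <= 1] `<=`
      [set y | dot ac.1 y <= ac.2]]) [set y | dot ac.1 y <= ac.2]).
  by apply: closed_bigI => -[a c] _; exact: cl.
apply/seteqP; split => y yP; first by move=> ac /(_ y yP).
split => [i|a a0 a1].
  have := yP (- delta_mx 0 i, 0) => /=; rewrite dotNl.
  have dE (z : 'rV[R]_m) : dot (delta_mx 0 i) z = z 0 i.
    rewrite /dot (bigD1 i)//= mxE !eqxx mul1r big1 ?addr0// => j ji.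
    by rewrite mxE (negbTE ji) andbF mul0r.
  rewrite dE oppr_le0; apply => z [z0 _] /=.
  by rewrite dotNl dE oppr_le0; exact: z0.
by apply: (yP (a, 1)) => z [_]; exact.
Qed.

Lemma lq_orthant0 m : (lq_ball q `&` @orthant R m) 0.
Proof.
have [p1 q1 _] := pq.
split; last by move=> i; rewrite mxE.
by rewrite /lq_ball/= big1 ?ler01// => i _; rewrite mxE normr0 powR0// gt_eqF//; lra.
Qed.

Lemma zonotope0 m n (T : 'M[R]_(m, n)) : zonotope T 0.
Proof. by exists 0; [exact: lq_orthant0|rewrite mul0mx]. Qed.

Lemma compact_zonotope m n (T : 'M[R]_(m, n)) : compact (zonotope T).
Proof.
apply: continuous_compact; last exact: compact_lq_orthant.
by apply: continuous_subspaceT; exact: continuous_mulmxr.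
Qed.

Lemma convex_zonotope m n (T : 'M[R]_(m, n)) : convex_set (zonotope T).
Proof.
apply: convex_setI01 => _ _ t t0 t1 [x xP <-] [y yP <-].
exists (t *: x + (1 - t) *: y); first exact: (convex_setD (@convex_lq_orthant m)).
by rewrite mulmxDl !scalemxAl.
Qed.

Lemma support_pow_ge0 m n (T : 'M[R]_(m, n)) x : 0 <= support_pow T x.
Proof. exact: sum_powR_ge0. Qed.

(** The upper bound is Hölder's inequality for the positive parts of the <x, v_i>.
    It is attained in the equality case, where y_i = 0 if <x, v_i> <= 0. *)
Lemma support_zonotope m n (T : 'M[R]_(m, n)) x :
  support_fun (zonotope T) x = support_pow T x `^ (1 / p).
Proof.
have [p1 q1 _] := pq.
pose a i := Num.max 0 ((x *m T^T) 0 i).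
have a0 i : 0 <= a i by rewrite le_max lexx.
have [y [y0 y1 y2 yE]] := holder_attained pq a0.
have dxT (z : 'rV[R]_m) : dot x (z *m T) = \sum_i (x *m T^T) 0 i * z 0 i.
  by rewrite dot_mulmx.
have yx : dot x (\row_i y i *m T) = support_pow T x `^ (1 / p).
  rewrite dxT -yE; apply: eq_bigr => i _; rewrite mxE.
  have [xi|xi] := leP 0 ((x *m T^T) 0 i); first by rewrite /a max_r.
  by rewrite y2 ?mulr0// /a max_l// ltW.
rewrite -yx; apply: support_fun_max.
  exists (\row_i y i) => //; split; last by move=> i; rewrite mxE.
  by rewrite /lq_ball/=; under eq_bigr do rewrite mxE ger0_norm//.
move=> _ [z [z1 z0] <-]; rewrite yx dxT.
have z1' : \sum_i z 0 i `^ q <= 1.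
  by move: z1; rewrite /lq_ball/=; under eq_bigr do rewrite (ger0_norm (z0 _)).
apply: le_trans (holder_unit pq a0 z0 z1').
by apply: ler_sum => i _; rewrite ler_wpM2r ?z0// le_max lexx orbT.
Qed.

Lemma zonotope_eqP m m' n (T : 'M[R]_(m, n)) (T' : 'M[R]_(m', n)) :
  zonotope T = zonotope T' <-> forall x, support_pow T x = support_pow T' x.
Proof.
have [p1 q1 _] := pq.
split => [TT' x|TT'].
  have := congr1 (fun K => support_fun K x `^ p) TT'.
  by rewrite !support_zonotope !powR_rootK ?support_pow_ge0.
apply: support_fun_inj; do ?[exact: compact_zonotope|exact: convex_zonotope|
  by exists 0; exact: zonotope0].
by move=> x; rewrite !support_zonotope TT'.
Qed.

Lemma support_pow_col_mx m m' n (T : 'M[R]_(m, n)) (T' : 'M[R]_(m', n)) x :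
  support_pow (col_mx T T') x = support_pow T x + support_pow T' x.
Proof.
rewrite /support_pow big_split_ord/=.
by congr (_ + _); apply: eq_bigr => i _;
  rewrite tr_col_mx mul_mx_row ?row_mxEl ?row_mxEr.
Qed.

Lemma Lp_sum_zonotope m m' n (T : 'M[R]_(m, n)) (T' : 'M[R]_(m', n)) :
  Lp_sum p (zonotope T) (zonotope T') = zonotope (col_mx T T').
Proof.
have [p1 q1 _] := pq.
apply: Lp_sumE; do ?[exact: compact_zonotope|exact: convex_zonotope|
  by exists 0; exact: zonotope0].
by move=> x; rewrite !support_zonotope !powR_rootK ?support_pow_ge0// support_pow_col_mx.
Qed.

Lemma Lp_bigsum_zonotope n k (S : 'I_k -> set 'rV[R]_n) (m : 'I_k -> nat)
    (T : forall i, 'M[R]_(m i, n)) : (forall i, S i = zonotope (T i)) ->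
  exists M (T' : 'M[R]_(M, n)), Lp_bigsum p S = zonotope T' /\
    forall x, support_pow T' x = \sum_i support_pow (T i) x.
Proof.
rewrite /Lp_bigsum; elim: k S m T => [|k IH] S m T ST.
  exists 0%N, 0; split => [|x]; last by rewrite /support_pow !big_ord0.
  rewrite big_ord0; apply/seteqP; split => [_ ->|_ [y _ <-]]; first exact: zonotope0.
  by rewrite mulmx0.
have [M [T' [SE TE]]] := IH _ _ _ (fun i => ST (lift ord0 i)).
exists (m ord0 + M)%N, (col_mx (T ord0) T'); rewrite big_ord_recl SE ST Lp_sum_zonotope.
by split => // x; rewrite support_pow_col_mx big_ord_recl TE.
Qed.

End Zonotopes.
Section ZonotopeDescriptions.
Context {R : realType}.
Context (p q : R) (pq : conjugate_exponents p q).

Lemma support_pow0 m n (x : 'rV[R]_n) : support_pow p (0 : 'M[R]_(m, n)) x = 0.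
Proof.
have [p1 _ _] := pq; rewrite /support_pow big1// => i _.
by rewrite trmx0 mulmx0 mxE maxxx powR0// gt_eqF//; lra.
Qed.

Lemma zonotope_pairP n (a b z : 'rV[R]_n) : zonotope q (col_mx a b) z <->
  exists s t : R, [/\ 0 <= s, 0 <= t, s `^ q + t `^ q <= 1 & z = s *: a + t *: b].
Proof.
split => [[y [y1 y0] <-]|[s [t [s0 t0 st ->]]]].
  exists (lsubmx y 0 0), (rsubmx y 0 0); rewrite !mxE !y0; split => //.
    move: y1; rewrite /lq_ball/= big_split_ord/= !big_ord1.
    by rewrite !ger0_norm.
  rewrite -{1}[y]hsubmxK mul_row_col.
  by rewrite [lsubmx y]mx11_scalar [rsubmx y]mx11_scalar !mul_scalar_mx !mxE.
exists (row_mx s%:M t%:M); last by rewrite /= mul_row_col !mul_scalar_mx.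
split => [|i]; last by rewrite mxE; case: (fintype.split i) => j; rewrite ord1 mxE eqxx mulr1n.
by rewrite /lq_ball/= big_split_ord/= !big_ord1 row_mxEl row_mxEr !mxE !eqxx
  !mulr1n !ger0_norm.
Qed.

Lemma powR_pair_le1 (s t : R) : 0 <= s -> 0 <= t -> s `^ q + t `^ q <= 1 ->
  s <= 1 /\ t <= 1.
Proof.
have [_ q1 _] := pq.
suff le1 (x y : R) : 0 <= x -> x `^ q + y `^ q <= 1 -> x <= 1.
  move=> s0 t0 st; split; first exact: le1 st.
  by apply: (le1 _ s) => //; rewrite addrC.
move=> x0 xy; rewrite leNgt; apply/negP => x1.
have : 1 `^ q < x `^ q by rewrite gt0_ltr_powR ?nnegrE ?ler01//; lra.
by rewrite powR1; have := powR_ge0 y q; lra.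
Qed.

(** As 0 lies between a and b, either b = 0 or a = - k b with k >= 0. Hence s a and
    t b point in opposite directions, and s a + t b stays between a and b. *)
Lemma segment_zonotope n (a b : 'rV[R]_n) :
  segment a b 0 -> segment a b = zonotope q (col_mx a b).
Proof.
have [_ q1 _] := pq; have q0 : 0 < q by lra.
have zq : 0 `^ q = 0 :> R by rewrite powR0// gt_eqF.
move=> [t0 /=]; rewrite in_itv/= => /andP[t00 t01] ab0.
have [t0E|t0N] := eqVneq t0 1.
  have b0 : b = 0 by rewrite -ab0 t0E subrr scale0r add0r scale1r.
  apply/seteqP; split => [_ [t /= + <-]|z /zonotope_pairP[s [t [s0 tt0 st ->]]]].
    rewrite in_itv/= => /andP[tt0 t1]; apply/zonotope_pairP.
    exists (1 - t), 0; rewrite b0 !scaler0 zq addr0; split => //; first by lra.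
    by apply: powR_le1; lra.
  have [s1 _] := powR_pair_le1 s0 tt0 st.
  exists (1 - s); first by rewrite /= in_itv/=; apply/andP; split; lra.
  by rewrite b0 !scaler0 !addr0; congr (_ *: _); ring.
have d0 : 0 < 1 - t0 by rewrite subr_gt0 lt_neqAle t0N.
pose k := t0 / (1 - t0).
have k0 : 0 <= k by rewrite divr_ge0// ltW.
have aE : a = - k *: b.
  have := congr1 (fun z => (1 - t0)^-1 *: z) ab0.
  rewrite scaler0 scalerDr !scalerA mulVf ?gt_eqF// scale1r mulrC => /eqP.
  by rewrite addr_eq0 => /eqP ->; rewrite scaleNr.
apply/seteqP; split => [_ [r /= + <-]|z /zonotope_pairP[s [t [s0 tt0 st ->]]]].
  rewrite in_itv/= => /andP[r0 r1]; apply/zonotope_pairP.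
  (* The point is (r - k (1 - r)) b: a nonnegative multiple of b, or else of a. *)
  have [c0|c0] := leP 0 (r - k * (1 - r)).
    exists 0, (r - k * (1 - r)); rewrite zq add0r; split => //.
      have kr : 0 <= k * (1 - r) by rewrite mulr_ge0//; lra.
      by apply: powR_le1 => //; lra.
    by rewrite scale0r add0r aE scalerA -scalerDl; congr (_ *: _); ring.
  have kp : 0 < k.
    by rewrite lt_neqAle k0 andbT eq_sym; apply/eqP => kz; move: c0; rewrite kz; lra.
  have sE : (k * (1 - r) - r) / k = (1 - r) - r / k.
    by rewrite mulrBl [k * _]mulrC mulfK// gt_eqF.
  have rk : 0 <= r / k by rewrite divr_ge0.
  exists ((k * (1 - r) - r) / k), 0; rewrite zq addr0; split => //.
  - by rewrite divr_ge0//; lra.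
  - apply: powR_le1; [by rewrite divr_ge0//; lra| |lra].
    by rewrite sE; lra.
  - rewrite scale0r addr0 aE !scalerA -scalerDl; congr (_ *: _).
    by rewrite [RHS]mulrN divfK ?gt_eqF//; ring.
have [s1 t1] := powR_pair_le1 s0 tt0 st.
have k1 : 0 < 1 + k by lra.
(* This is the solution r of r - k (1 - r) = t - k s. *)
exists ((t + k * (1 - s)) / (1 + k)).
  rewrite /= in_itv/=; apply/andP; split.
    have ks : 0 <= k * (1 - s) by rewrite mulr_ge0//; lra.
    by rewrite divr_ge0//; lra.
  by rewrite ler_pdivrMr//; nra.
rewrite aE !scalerA -!scalerDl; congr (_ *: _).
set r := _ / _; have rE : r * (1 + k) = t + k * (1 - s) by rewrite divfK// gt_eqF.
have -> : (1 - r) * - k + r = r * (1 + k) - k by ring.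
by rewrite rE; ring.
Qed.

Lemma segment0 n (v : 'rV[R]_n) : segment 0 v 0.
Proof.
exists 0; first by rewrite /= in_itv/= lexx ler01.
by rewrite scaler0 scale0r addr0.
Qed.

Lemma zonotope_Lp_bigsum n k (v : 'I_k -> 'rV[R]_n) :
  Lp_bigsum p (fun i => segment 0 (v i)) = zonotope q (\matrix_i v i).
Proof.
have [M [T [-> TE]]] :=
  Lp_bigsum_zonotope pq (fun i => segment_zonotope (segment0 (v i))).
apply/(zonotope_eqP pq) => x; rewrite TE; apply: eq_bigr => i _.
rewrite support_pow_col_mx support_pow0 add0r /support_pow big_ord1.
congr (Num.max _ _ `^ _); rewrite !mxE; apply: eq_bigr => j _.
by rewrite !mxE.
Qed.

Lemma asymmetric_Lp_zonotopeE n (Z : set 'rV[R]_n) : asymmetric_Lp_zonotope p Z ->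
  exists m (T : 'M[R]_(m, n)), Z = zonotope q T.
Proof.
move=> [k [a [b [ab0 ->]]]].
have [M [T [-> _]]] := Lp_bigsum_zonotope pq (fun i => segment_zonotope (ab0 i)).
by exists M, T.
Qed.

Lemma zonotope_asymmetric m n (T : 'M[R]_(m, n)) :
  asymmetric_Lp_zonotope p (zonotope q T).
Proof.
exists m, (fun=> 0), (fun i => row i T); split; first by move=> i; exact: segment0.
rewrite zonotope_Lp_bigsum; congr zonotope.
by apply/matrixP => i j; rewrite !mxE.
Qed.

Lemma zonotopeN m n (T : 'M[R]_(m, n)) : -%R @` zonotope q T = zonotope q (- T).
Proof.
apply/seteqP; split => [_ [_ [y yP <-] <-]|_ [y yP <-]].
  by exists y => //; rewrite mulmxN.
by exists (y *m T); [exists y|rewrite mulmxN].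
Qed.

(** The positive and negative parts of y are the coefficients of the rows of T and
    of - T. Conversely, |a - b|^q <= a^q + b^q for a, b >= 0. *)
Lemma lq_ball_zonotope m n (T : 'M[R]_(m, n)) :
  (fun y => y *m T) @` lq_ball q = zonotope q (col_mx T (- T)).
Proof.
have [_ q1 _] := pq; have q0 : q != 0 by rewrite gt_eqF//; lra.
apply/seteqP; split => [_ [y y1 <-]|_ [y [y1 y0] <-]].
  exists (row_mx (\row_i Num.max 0 (y 0 i)) (\row_i Num.max 0 (- y 0 i))).
    split => [|i]; last by rewrite mxE; case: (fintype.split i) => j; rewrite mxE le_max lexx.
    move: y1; rewrite /lq_ball/= big_split_ord/= -big_split/=.
    congr (_ <= 1); apply: eq_bigr => i _; rewrite row_mxEl row_mxEr !mxE.
    have [yi|yi] := leP 0 (y 0 i).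
      by rewrite max_l ?oppr_le0// normr0 powR0// addr0.
    rewrite normr0 powR0// add0r max_r ?oppr_ge0 ?(ltW yi)//.
    by rewrite normrN.
  rewrite mul_row_col mulmxN -mulmxBl; congr (_ *m _); apply/rowP => i; rewrite !mxE.
  have [yi|yi] := leP 0 (y 0 i); first by rewrite max_l ?oppr_le0// subr0.
  by rewrite max_r ?oppr_ge0 ?(ltW yi)// opprK add0r.
exists (lsubmx y - rsubmx y).
  apply: le_trans y1; rewrite big_split_ord/= -big_split/=.
  apply: ler_sum => i _; rewrite !mxE.
  have := y0 (lshift m i); have := y0 (rshift m i).
  set b := y 0 (rshift m i); set a := y 0 (lshift m i) => b0 a0.
  rewrite (ger0_norm a0) (ger0_norm b0).
  have mono (x z : R) : `|x| <= z -> `|x| `^ q <= z `^ q.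
    move=> xz; apply: ge0_ler_powR; rewrite ?nnegrE//; first by lra.
    exact: le_trans xz.
  have pa := powR_ge0 a q; have pb := powR_ge0 b q.
  have [ab|ab] := leP b a.
    by apply: le_trans (mono _ a _) _; [rewrite ler_norml; apply/andP; split; lra|lra].
  by apply: le_trans (mono _ b _) _; [rewrite ler_norml; apply/andP; split; lra|lra].
by rewrite -{3}[y]hsubmxK mul_row_col mulmxN mulmxBl.
Qed.

End ZonotopeDescriptions.

(** * Orthonormal bases and orthogonal projections *)

Section OrthonormalBasis.
Context {R : realType}.

Definition orthonormal_seq m (Y : seq 'rV[R]_m) :=
  all (fun y => dot y y == 1) Y && pairwise (fun y z => dot y z == 0) Y.

Lemma dot_suml n I (r : seq I) (F : I -> 'rV[R]_n) v :
  dot (\sum_(i <- r) F i) v = \sum_(i <- r) dot (F i) v.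
Proof.
apply: (big_morph (fun u => dot u v)) => [u w|]; first exact: dotDl.
by rewrite dotE mul0mx mxE.
Qed.

Lemma orthonormal_seq_sum m (Y : seq 'rV[R]_m) y (f : 'rV[R]_m -> R) :
  orthonormal_seq Y -> y \in Y -> \sum_(z <- Y) f z * dot z y = f y.
Proof.
elim: Y => // z Y IH /andP[/= /andP[/eqP z1 Y1] /andP[/allP zY YY]].
have oY : orthonormal_seq Y by rewrite /orthonormal_seq Y1.
rewrite inE big_cons => /predU1P[->|yY].
  rewrite z1 mulr1 big_seq big1 ?addr0// => w /zY; rewrite dotC => /eqP ->.
  by rewrite mulr0.
by rewrite (eqP (zY _ yY)) mulr0 add0r IH.
Qed.

Lemma span_dot0 m (X : seq 'rV[R]_m) x v :
  (forall z, z \in X -> dot x z = 0) -> v \in <<X>>%VS -> dot x v = 0.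
Proof.
move=> xX; have /subvP : (<<X>> <= lker (linfun (mulmxr x^T : 'rV[R]_m -> 'M[R]_1)))%VS.
  apply/span_subvP => z /xX xz; rewrite memv_ker lfunE/=.
  by apply/eqP/matrixP => i j; rewrite !ord1 -dotE dotC xz mxE.
move=> /[apply]; rewrite memv_ker lfunE/= => /eqP h.
by rewrite dotC dotE h mxE.
Qed.

Lemma gram_schmidt m (X : seq 'rV[R]_m) :
  exists2 Y, orthonormal_seq Y & <<Y>>%VS = <<X>>%VS.
Proof.
elim: X => [|x X [Y oY YX]]; first by exists [::].
pose s := \sum_(y <- Y) dot x y *: y; pose x' := x - s.
have sY : s \in <<Y>>%VS.
  by rewrite /s big_seq memv_suml// => y yY; rewrite memvZ// memv_span.
have x'Y y : y \in Y -> dot x' y = 0.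
  move=> yY; rewrite /x' dotDl dotNl dot_suml.
  under eq_bigr do rewrite dotZl.
  by rewrite (orthonormal_seq_sum (dot x) oY yY) subrr.
have [x'0|x'0] := eqVneq x' 0.
  exists Y => //; rewrite span_cons -YX; apply/esym/addv_idPr.
  by rewrite -memvE; move/eqP: x'0; rewrite subr_eq0 => /eqP ->.
have n0 : 0 < enorm x'.
  rewrite /enorm sqrtr_gt0 lt_neqAle dot_ge0 andbT eq_sym.
  by apply: contra x'0 => /eqP /dot_eq0 ->.
have nn : enorm x' ^+ 2 = dot x' x' by rewrite sqr_sqrtr// dot_ge0.
pose u := (enorm x')^-1 *: x'.
exists (u :: Y).
  have /andP[oY1 oY2] := oY; rewrite /orthonormal_seq/= oY1 oY2 !andbT.
  have -> : dot u u = 1 by rewrite /u dotZl dotZr -nn; field; rewrite gt_eqF.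
  rewrite eqxx /=.
  by apply/allP => y yY; rewrite dotZl x'Y// mulr0.
rewrite !span_cons -YX; apply/eqP; rewrite eqEsubv !subv_add !addvSr !andbT -!memvE.
apply/andP; split.
  by rewrite /u memvZ// memv_add ?memv_line// memvN.
have -> : x = enorm x' *: u + s by rewrite /u scalerA divff ?gt_eqF// scale1r subrK.
by rewrite memv_add// memvZ// memv_line.
Qed.

Lemma orthonormal_seq_free m (Y : seq 'rV[R]_m) : orthonormal_seq Y -> free Y.
Proof.
elim: Y => [_|y Y IH]; first by rewrite nil_free.
move=> /andP[/= /andP[/eqP y1 Y1] /andP[/allP yY YY]].
rewrite free_cons IH ?andbT; last by rewrite /orthonormal_seq Y1.
apply/negP => /(span_dot0 (fun z zY => eqP (yY z zY))).
by rewrite y1 => /eqP; rewrite oner_eq0.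
Qed.

Lemma orthonormal_basis_exists m (E : {vspace 'rV[R]_m}) :
  exists u : (\dim E).-tuple 'rV[R]_m, orthonormal_basis u.
Proof.
have [Y oY YE] := gram_schmidt (vbasis E).
rewrite (span_basis (vbasisP E)) in YE.
have fY := orthonormal_seq_free oY.
have sY : size Y == \dim E by rewrite -YE; rewrite eq_sym.
exists (Tuple sY); split; first by rewrite /basis_of/= YE eqxx.
have /andP[/all_nthP oY1 oY2] := oY.
have lt i j : (i < j < size Y)%N -> dot (nth 0 Y i) (nth 0 Y j) = 0.
  move=> /andP[ij jY]; apply/eqP.
  by move/(pairwiseP 0): oY2; apply => //; rewrite inE//; exact: ltn_trans jY.
move=> i j; rewrite !(tnth_nth 0)/=.
have iY : (i < size Y)%N by rewrite (eqP sY).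
have jY : (j < size Y)%N by rewrite (eqP sY).
have [->|ij] := eqVneq i j; first by apply/eqP/oY1.
have /orP[ltij|ltji] : (i < j)%N || (j < i)%N by rewrite -neq_ltn.
  by rewrite lt// ltij.
by rewrite dotC lt// ltji.
Qed.

(** The columns of T are an orthonormal basis of E, the one in which
    [lebesgue_vspace E] measures. *)
Definition frame m n (E : {vspace 'rV[R]_m}) (T : 'M[R]_(m, n)) :=
  [/\ T^T *m T = 1%:M, forall x, orth_proj E x = x *m T *m T^T,
    forall x, (x \in E) = (x *m T *m T^T == x) &
    forall A, lebesgue_vspace E A = lebesgue_rV [set x : 'rV[R]_n | A (x *m T^T)]].

Lemma frame_exists m n (E : {vspace 'rV[R]_m}) : \dim E = n ->
  exists T : 'M[R]_(m, n), frame E T.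
Proof.
move=> dE; subst n; rewrite /frame /lebesgue_vspace.
set u := xget _ _.
have [ub uo] : orthonormal_basis u.
  have [v vP] := orthonormal_basis_exists E.
  by apply: xgetPex; exists v.
clearbody u; pose T := \matrix_(i < m, j < \dim E) tnth u j 0 i.
have TT : T^T *m T = 1%:M.
  apply/matrixP => i j; rewrite !mxE -uo; apply: eq_bigr => k _.
  by rewrite !mxE.
have xT (x : 'rV[R]_(\dim E)) : x *m T^T = \sum_i x 0 i *: tnth u i.
  rewrite mulmx_sum_row; apply: eq_bigr => i _; congr (_ *: _).
  by apply/rowP => j; rewrite !mxE.
have TE x : x *m T^T \in E.
  rewrite xT memv_suml// => i _; rewrite memvZ// (basis_mem ub)//.
  exact: mem_tnth.
have ET x : (x \in E) = (x *m T *m T^T == x).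
  apply/idP/eqP => [xE|<-]; last exact: TE.
  have [c ->] : exists c, x = c *m T^T.
    exists (\row_i coord u i x); rewrite xT {1}(coord_basis ub xE).
    by apply: eq_bigr => i _; rewrite mxE (tnth_nth 0).
  by rewrite -(mulmxA c) TT mulmx1.
exists T; split => // [x|A].
  rewrite /orth_proj; set S := [set y | _].
  have Sx : S (x *m T *m T^T).
    split => // e; rewrite ET => /eqP eE.
    rewrite dotDl dotNl -{1}eE -mulmxA dot_mulmx trmx_mul trmxK mulmxA subrr//.
  have [yE yP] : S (get S) by apply: getPex; exists (x *m T *m T^T).
  set y := get S in yE yP *; apply/eqP; rewrite -subr_eq0; apply/eqP/dot_eq0.
  have dE : y - x *m T *m T^T \in E by rewrite memvB.
  have := Sx.2 _ dE; have := yP _ dE; set d := y - _ in dE *.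
  have -> : x - x *m T *m T^T = (x - y) + d by rewrite /d addrA subrK.
  by move=> h; rewrite [X in X = 0 -> _]dotDl h add0r.
by congr lebesgue_rV; apply/seteqP; split => x /=; rewrite xT.
Qed.

(** In the orthonormal coordinates given by T, the projection of y is y T. *)
Lemma frame_image m n (E : {vspace 'rV[R]_m}) (T : 'M[R]_(m, n)) (K : set 'rV[R]_m) :
  frame E T -> lebesgue_vspace E (orth_proj E @` K) = lebesgue_rV ((fun y => y *m T) @` K).
Proof.
move=> [TT pE _ ->]; congr lebesgue_rV; apply/seteqP; split => [x [y Ky]|_ [y Ky <-]].
  rewrite pE => /(congr1 (fun z => z *m T)); rewrite -!(mulmxA _ T^T) TT !mulmx1.
  by move=> <-; exists y.
by exists y => //; rewrite pE.
Qed.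

End OrthonormalBasis.
(** * Zonotopes that are sums of n segments *)

Section EqualityCase.
Context {R : realType}.
Context (p q : R) (pq : conjugate_exponents p q).

Lemma support_pow_mulmx m k n (C : 'M[R]_(m, k)) (S : 'M[R]_(k, n)) x :
  support_pow p (C *m S) x = support_pow p C (x *m S^T).
Proof. by rewrite /support_pow trmx_mul mulmxA. Qed.

Lemma zonotope_mulmx m m' k n (C : 'M[R]_(m, k)) (D : 'M[R]_(m', k)) (S : 'M[R]_(k, n)) :
  zonotope q C = zonotope q D -> zonotope q (C *m S) = zonotope q (D *m S).
Proof.
move=> /(zonotope_eqP pq) CD; apply/(zonotope_eqP pq) => x.
by rewrite !support_pow_mulmx CD.
Qed.

Lemma support_pow_eq0 m n (T : 'M[R]_(m, n)) x :
  support_pow p T x = 0 -> forall i, (x *m T^T) 0 i <= 0.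
Proof.
move=> /sum_powR_eq0 h i; have := h i.
by case: leP => // xi /eqP; rewrite gt_eqF.
Qed.

(** Each row of C is a nonnegative multiple of one e_j, so that the rows along e_j
    amount to a single one, whose coefficient is their p-norm. *)
Lemma support_pow_disjoint m n (C : 'M[R]_(m, n)) z :
  (forall i j, 0 <= C i j) ->
  (forall i j k, C i j != 0 -> C i k != 0 -> j = k) ->
  support_pow p C z = \sum_j (\sum_i C i j `^ p) * Num.max 0 (z 0 j) `^ p.
Proof.
have [p1 q1 _] := pq; have zp : 0 `^ p = 0 :> R by rewrite powR0// gt_eqF//; lra.
move=> C0 C1; under [RHS]eq_bigr do rewrite mulr_suml.
rewrite exchange_big/=; apply: eq_bigr => i _.
have [[j Cj]|Ci] := pselect (exists j, C i j != 0).
  have CE k : k != j -> C i k = 0.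
    move=> kj; apply/eqP; apply: contraTT kj => Ck; rewrite negbK.
    by apply/eqP; exact: C1 Ck Cj.
  rewrite (bigD1 j)//= [X in _ + X]big1 ?addr0 => [|k kj].
    rewrite -powRM ?le_max ?lexx//; congr (_ `^ _).
    rewrite mxE (bigD1 j)//= big1 ?addr0 => [|k kj].
      by rewrite mxE maxr_pMr// mulr0 mulrC.
    by rewrite mxE CE// mulr0.
  by rewrite CE// zp mul0r.
have CE k : C i k = 0 by apply/eqP/negPn/negP => Ck; apply: Ci; exists k.
rewrite [RHS]big1 => [|k _]; last by rewrite CE zp mul0r.
by rewrite mxE big1 ?maxxx ?zp// => k _; rewrite mxE CE mulr0.
Qed.

(** Each c_j^p = c_j c_j^(p-1) is at most c_j s^(p-1), where s is the sum of c. *)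
Lemma sum_powR_le_powR_sum n (c : 'I_n -> R) : (forall j, 0 <= c j) ->
  \sum_j c j `^ p <= (\sum_j c j) `^ p.
Proof.
have [p1 q1 _] := pq.
move=> c0; have s0 : 0 <= \sum_j c j by apply: sumr_ge0.
rewrite -(mulr_powRB1 s0); last by lra.
rewrite mulr_suml; apply: ler_sum => j _.
rewrite -(mulr_powRB1 (c0 j)); last by lra.
rewrite ler_wpM2l// ge0_ler_powR ?nnegrE//; first by lra.
by rewrite (bigD1 j)//= lerDl sumr_ge0.
Qed.

(** Equality in [sum_powR_le_powR_sum] forces c_j = s wherever c_j is not 0, with s
    the sum of c; this can happen only once. *)
Lemma sum_powR_eq_powR_sum n (c : 'I_n -> R) : (forall j, 0 <= c j) ->
  \sum_j c j `^ p = (\sum_j c j) `^ p ->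
  forall j k, c j != 0 -> c k != 0 -> j = k.
Proof.
have [p1 q1 _] := pq.
move=> c0; have s0 : 0 <= \sum_j c j by apply: sumr_ge0.
set s := \sum_j c j in s0 *.
have cs j : c j <= s by rewrite /s (bigD1 j)//= lerDl sumr_ge0.
rewrite -(mulr_powRB1 s0); last by lra.
rewrite mulr_suml => E.
have dE : \sum_j c j * (s `^ (p - 1) - c j `^ (p - 1)) = 0.
  rewrite (eq_bigr (fun j => c j * s `^ (p - 1) - c j `^ p)).
    by rewrite sumrB -E subrr.
  by move=> j _; rewrite mulrBr mulr_powRB1//; lra.
have cE j : c j != 0 -> c j = s.
  move=> cj; have := dE => /eqP; rewrite psumr_eq0 => [|k _]; last first.
    by rewrite mulr_ge0// subr_ge0 ge0_ler_powR ?nnegrE//; lra.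
  move=> /allP/(_ j (mem_index_enum _)); rewrite /= mulf_eq0 (negbTE cj)/= subr_eq0.
  move=> /eqP h; apply: (@powR_injective _ (p - 1)); rewrite ?inE ?nnegrE//; lra.
move=> j k cj ck; apply/eqP/negP => /negP jk.
have : c j + c k <= s.
  by rewrite /s (bigD1 j)//= (bigD1 k) 1?eq_sym//= addrA lerDl sumr_ge0.
have : 0 < c j by rewrite lt_neqAle eq_sym cj c0.
by rewrite (cE j cj) (cE k ck); lra.
Qed.

(** The value at - e_j shows that the entries are nonnegative, and the value at e_j
    that the columns have p-norm 1. At (1, ..., 1), the p-th powers of the row sums
    add up to n, as do the p-th powers of all entries: each row is then in the
    equality case of [sum_powR_le_powR_sum]. *)
Lemma support_pow_eq_id m n (C : 'M[R]_(m, n)) :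
  (forall z, support_pow p C z = support_pow p (1%:M : 'M[R]_n) z) ->
  [/\ forall i j, 0 <= C i j, forall j, \sum_i C i j `^ p = 1 &
      forall i j k, C i j != 0 -> C i k != 0 -> j = k].
Proof.
have [p1 q1 _] := pq; have zp : 0 `^ p = 0 :> R by rewrite powR0// gt_eqF//; lra.
move=> CE.
have idE z : support_pow p (1%:M : 'M[R]_n) z = \sum_j Num.max 0 (z 0 j) `^ p.
  by apply: eq_bigr => j _; rewrite trmx1 mulmx1.
have eC j i : ((delta_mx 0 j : 'rV[R]_n) *m C^T) 0 i = C i j by rewrite -rowE !mxE.
have C0 i j : 0 <= C i j.
  have : support_pow p C (- delta_mx 0 j) = 0.
    rewrite CE idE big1// => k _; rewrite !mxE.
    by case: eqP => _; rewrite ?oppr0 ?maxxx ?zp// max_l// oppr_le0.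
  by move=> /support_pow_eq0/(_ i); rewrite mulNmx mxE eC oppr_le0.
have C1 j : \sum_i C i j `^ p = 1.
  have := CE (delta_mx 0 j); rewrite idE (bigD1 j)//= big1 => [|k kj]; last first.
    by rewrite mxE (negbTE kj) andbF maxxx zp.
  rewrite mxE !eqxx max_r// powR1 addr0 => <-.
  by apply: eq_bigr => i _; rewrite eC max_r.
split => //.
have := CE (const_mx 1); rewrite idE.
have -> : \sum_(j < n) Num.max 0 ((const_mx 1 : 'rV[R]_n) 0 j) `^ p =
    \sum_j \sum_i C i j `^ p.
  by apply: eq_bigr => j _; rewrite mxE max_r// powR1 C1.
rewrite exchange_big/= => sE i; apply: sum_powR_eq_powR_sum => //.
have d0 k : 0 <= (\sum_j C k j) `^ p - \sum_j C k j `^ p.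
  by rewrite subr_ge0 sum_powR_le_powR_sum.
have : \sum_k ((\sum_j C k j) `^ p - \sum_j C k j `^ p) = 0.
  rewrite big_split/= sumrN -sE; apply/eqP; rewrite subr_eq0; apply/eqP.
  apply: eq_bigr => k _; congr (_ `^ _).
  have -> : ((const_mx 1 : 'rV[R]_n) *m C^T) 0 k = \sum_j C k j.
    by rewrite mxE; apply: eq_bigr => j _; rewrite !mxE mul1r.
  by rewrite max_r// sumr_ge0.
move=> /eqP; rewrite psumr_eq0// => /allP/(_ i (mem_index_enum _)).
by rewrite /= subr_eq0 => /eqP.
Qed.

Definition split_by_cones m n (E : {vspace 'rV[R]_m}) :=
  exists U : 'I_n.+1 -> {set 'I_m},
    [/\ partition_family U,
        forall j : 'I_n, U (lift ord0 j) != finset.set0,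
        forall i : 'I_m, i \in U ord0 <-> orth_proj E (delta_mx 0 i) = 0 &
        exists w : 'I_n -> 'rV[R]_m,
          (forall j : 'I_n,
             enorm (w j) = 1 /\ open_cone (U (lift ord0 j)) (w j)) /\
          E = <<[seq w j | j : 'I_n]>>%VS].

Lemma non_unit_kernel n (V : 'M[R]_n) : V \notin unitmx ->
  exists2 x : 'rV_n, x != 0 & x *m V = 0.
Proof.
rewrite -row_free_unit -kermx_eq0 => /rowV0Pn[x xk x0].
by exists x => //; apply/sub_kermxP.
Qed.

(** The matrix C = T V^-1 satisfies the conclusions of [support_pow_eq_id]. The set
    U_j is the support of its j-th column, w_j is this column scaled to norm 1, and
    E is the column span of T, hence of C. *)
Lemma zonotope_simplex_cones m n (E : {vspace 'rV[R]_m}) (T : 'M[R]_(m, n))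
    (V : 'M[R]_n) : frame E T -> zonotope q T = zonotope q V -> split_by_cones n E.
Proof.
have [p1 q1 _] := pq.
move=> [TT pE ET _] /(zonotope_eqP pq) TV.
have uV : V \in unitmx.
  (* If V x = 0, the support function of T vanishes at x and at - x. *)
  rewrite -unitmx_tr; apply/negPn/negP => /non_unit_kernel[x x0 xV].
  have sV0 (y : 'rV[R]_n) : y *m V^T = 0 -> support_pow p T y = 0.
    move=> yV; rewrite TV /support_pow big1// => i _.
    by rewrite yV mxE maxxx powR0// gt_eqF//; lra.
  have h1 := support_pow_eq0 (sV0 x xV).
  have h2 := support_pow_eq0 (sV0 (- x) _).
  have xT : x *m T^T = 0.
    apply/rowP => i; rewrite [RHS]mxE; apply/le_anti; rewrite h1/=.
    rewrite -oppr_le0; have := h2 _ i; rewrite !mulNmx xV oppr0 mxE.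
    by move=> /(_ erefl); rewrite mxE.
  by move: x0; rewrite -[x]mulmx1 -TT mulmxA xT mul0mx eqxx.
pose C := T *m invmx V.
have TC : T = C *m V by rewrite mulmxKV.
have [C0 C1 C2] : [/\ forall i j, 0 <= C i j, forall j, \sum_i C i j `^ p = 1 &
      forall i j k, C i j != 0 -> C i k != 0 -> j = k].
  by apply: support_pow_eq_id => z; rewrite support_pow_mulmx TV -support_pow_mulmx mulmxV.
pose U (k : 'I_n.+1) : {set 'I_m} := if unlift ord0 k is Some j
  then [set i | C i j != 0]%SET else [set i | [forall j, C i j == 0]]%SET.
have U0 : U ord0 = [set i | [forall j, C i j == 0]]%SET by rewrite /U unlift_none.
have UL j : U (lift ord0 j) = [set i | C i j != 0]%SET by rewrite /U liftK.
have [Cn0 wE] : (forall j, exists i, C i j != 0) /\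
    forall j, row j C^T = row j (invmx V)^T *m T^T.
  split => [j|j]; last by rewrite -row_mul /C trmx_mul.
  apply: contrapT => Cj; have := C1 j; rewrite big1 => [/eqP|i _].
    by rewrite eq_sym oner_eq0.
  rewrite (_ : C i j = 0) ?powR0 ?gt_eqF//; first by lra.
  by apply/eqP/negPn/negP => Cij; apply: Cj; exists i.
clearbody C.
have nw j : 0 < enorm (row j C^T).
  rewrite /enorm sqrtr_gt0 lt_neqAle dot_ge0 andbT eq_sym.
  have [i Cij] := Cn0 j; apply: contra Cij => /eqP/dot_eq0/rowP/(_ i).
  by rewrite !mxE => ->.
exists U; split.
- move=> i; have [[j Cj]|Ci] := pselect (exists j, C i j != 0).
    exists (lift ord0 j); split; first by rewrite UL inE.
    move=> k; case: (unliftP ord0 k) => [l ->|->].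
      by rewrite UL inE => Cl; congr lift; exact: C2 Cj Cl.
    by rewrite U0 inE => /forallP/(_ j); rewrite (negbTE Cj).
  exists ord0; split; first rewrite U0 inE; first apply/forallP => j.
    by apply/negPn/negP => Cj; apply: Ci; exists j.
  move=> k; case: (unliftP ord0 k) => [l ->|->//].
  by rewrite UL inE => Cl; case: Ci; exists l.
- by move=> j; have [i Cij] := Cn0 j; apply/finset.set0Pn; exists i; rewrite UL inE.
- move=> i; rewrite U0 inE pE; split => [/forallP Ci|/(congr1 (mulmx^~ T))].
    rewrite -rowE TC row_mul (_ : row i C = 0) ?mul0mx//.
    by apply/rowP => j; rewrite [LHS]mxE [RHS]mxE; apply/eqP.
  rewrite -mulmxA TT mulmx1 mul0mx -rowE TC row_mul => /(congr1 (mulmx^~ (invmx V))).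
  rewrite mulmxK// mul0mx => /rowP Ci; apply/forallP => j.
  by have := Ci j; rewrite !mxE => ->.
exists (fun j => (enorm (row j C^T))^-1 *: row j C^T); split.
  move=> j; split.
    rewrite {1}/enorm dotZl dotZr -[dot _ _]sqr_sqrtr ?dot_ge0// -/(enorm _).
    rewrite (_ : _ * _ = 1) ?sqrtr1//; have := nw j; set e := enorm _ => e0.
    by field; rewrite gt_eqF.
  exists (fun i => (enorm (row j C^T))^-1 * C i j) => [i|].
    rewrite UL inE => Cij; rewrite mulr_gt0 ?invr_gt0//.
    by rewrite lt_neqAle eq_sym Cij C0.
  rewrite [X in _ *: X]row_sum_delta scaler_sumr.
  rewrite [RHS]big_mkcond/=; apply: eq_bigr => i _; rewrite !mxE scalerA.
  by rewrite UL inE; case: ifPn => // /negPn/eqP ->; rewrite mulr0 scale0r.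
apply/eqP; rewrite eqEsubv; apply/andP; split.
  apply/subvP => e; rewrite ET => /eqP <-.
  rewrite {2}TC trmx_mul mulmxA mulmx_sum_row memv_suml// => j _.
  rewrite memvZ// -[row j C^T](scalerKV (lt0r_neq0 (nw j))) memvZ//.
  by rewrite memv_span//; apply/fintype.imageP; exists j.
apply/span_subvP => _ /fintype.imageP[j _ ->]; rewrite memvZ// ET wE.
by rewrite -!mulmxA (mulmxA T^T) TT mul1mx.
Qed.

(** Let W have the orthonormal columns w_j. By [support_pow_disjoint] it has the
    same zonotope as a diagonal matrix, and W W^T is the projection onto E, so that
    T = W (W^T T). *)
Lemma cones_zonotope_simplex m n (E : {vspace 'rV[R]_m}) (T : 'M[R]_(m, n)) :
  frame E T -> split_by_cones n E -> exists V : 'M[R]_n, zonotope q T = zonotope q V.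
Proof.
have [p1 q1 _] := pq.
move=> [TT pE ET _] [U [Upart _ _ [w [wP Ew]]]].
pose W := \matrix_(i < m, j < n) w j 0 i.
have Wsupp i j : W i j != 0 -> i \in U (lift ord0 j) /\ 0 < W i j.
  have [_ [c c0 wE]] := wP j; rewrite mxE wE summxE.
  have [iU|iU] := boolP (i \in U (lift ord0 j)).
    move=> _; split => //; rewrite (bigD1 i)//= mxE mxE !eqxx mulr1 big1 ?addr0 ?c0//.
    by move=> k /andP[_ ki]; rewrite !mxE eq_sym (negbTE ki) mulr0.
  rewrite big1 ?eqxx// => k kU; rewrite !mxE.
  have [ik|_] := eqVneq i k; last by rewrite andbF mulr0.
  by move: iU; rewrite ik kU.
have W0 i j : 0 <= W i j.
  by have [->//|/Wsupp[_ /ltW]] := eqVneq (W i j) 0.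
have W1 i j k : W i j != 0 -> W i k != 0 -> j = k.
  move=> /Wsupp[ij _] /Wsupp[ik _]; have [l [_ lU]] := Upart i.
  by apply: (@lift_inj _ ord0); rewrite -(lU _ ij) -(lU _ ik).
have WW : W^T *m W = 1%:M.
  apply/matrixP => j k; rewrite !mxE.
  have [<-|jk] := eqVneq j k.
    have [w1 _] := wP j; transitivity (dot (w j) (w j)).
      by apply: eq_bigr => i _; rewrite !mxE.
    by rewrite -[LHS]sqr_sqrtr ?dot_ge0// -/(enorm _) w1 expr1n.
  rewrite big1// => i _; rewrite mxE; apply/eqP; rewrite mulf_eq0.
  by apply/norP => -[ij ik]; move/eqP: jk; apply; exact: W1 ij ik.
have EW e : e \in E -> e *m W *m W^T = e.
  have /subvP : (E <= lker (linfun (mulmxr (W *m W^T - 1%:M) : 'rV[R]_m -> 'rV[R]_m)))%VS.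
    rewrite Ew; apply/span_subvP => _ /fintype.imageP[j _ ->].
    have wW : w j = row j W^T by apply/rowP => i; rewrite !mxE.
    rewrite memv_ker lfunE/= mulmxBr mulmx1 wW mulmxA -!row_mul.
    by rewrite WW mul1mx subrr.
  move=> /[apply]; rewrite memv_ker lfunE/= mulmxBr mulmx1 mulmxA subr_eq0.
  by move/eqP.
have TW : T = W *m (W^T *m T).
  apply: trmx_inj; rewrite !trmx_mul trmxK; apply/row_matrixP => j.
  rewrite !row_mul EW// ET -!row_mul TT.
  by rewrite mul1mx.
clearbody W; pose N j := \sum_i W i j `^ p.
pose D : 'M[R]_n := diag_mx (\row_j N j `^ (1 / p)).
have N0 j : 0 <= N j by exact: sum_powR_ge0.
have [D0 DN Dp] : [/\ forall i j, i != j -> D i j = 0, forall j, 0 <= D j j &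
    forall j, D j j `^ p = N j].
  split => [i j ij|j|j].
  - by rewrite mxE (negbTE ij) mulr0n.
  - by rewrite !mxE eqxx mulr1n; exact: powR_ge0.
  - by rewrite !mxE eqxx mulr1n; exact: powR_rootK (N0 j).
clearbody D.
have WD : zonotope q W = zonotope q D.
  apply/(zonotope_eqP pq) => z; rewrite support_pow_disjoint// support_pow_disjoint.
  - apply: eq_bigr => j _; congr (_ * _).
    rewrite [RHS](bigD1 j)//= Dp [X in _ + X]big1 ?addr0// => i ij.
    by rewrite D0// powR0// gt_eqF//; lra.
  - by move=> i j; have [->|ij] := eqVneq i j; rewrite ?DN// D0.
  - move=> i j k; have [<-|ij] := eqVneq i j; last by rewrite D0// eqxx.
    by have [<-|ik] := eqVneq i k; last by rewrite (D0 i k)// eqxx.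
by exists (D *m (W^T *m T)); rewrite {1}TW; exact: zonotope_mulmx.
Qed.

End EqualityCase.
(** * The volume inequality for a matrix *)

Section SymmetrizationBound.
Context {R : realType}.
Context (p q : R) (pq : conjugate_exponents p q).

Lemma measurable_rV_zonotope m n (T : 'M[R]_(m, n)) : measurable_rV (zonotope q T).
Proof. exact: measurable_rV_compact (@compact_zonotope R p q pq m n T). Qed.

(** The claim of the first statement for the zonotope of a matrix of rank n
    ([zonotope_bound]), and that of the second one for an orthonormal basis of E
    ([frame_bound]). *)
Definition symmetrization_bound m n (T : 'M[R]_(m, n)) :=
  (lebesgue_rV (zonotope q (col_mx T (- T))) <=
     (2 ^+ n)%:E * lebesgue_rV (zonotope q T))%E /\
  (lebesgue_rV (zonotope q (col_mx T (- T))) =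
     ((2 ^+ n)%:E * lebesgue_rV (zonotope q T))%E <->
   exists V : 'M[R]_n, zonotope q T = zonotope q V).

Lemma zonotope_mulmxE m n k (T : 'M[R]_(m, k)) (S : 'M[R]_(k, n)) :
  zonotope q (T *m S) = (fun y => y *m S) @` zonotope q T.
Proof.
apply/seteqP; split => [_ [y yP <-]|_ [_ [y yP <-] <-]].
  by exists (y *m T); [exists y|rewrite mulmxA].
by exists y => //; rewrite mulmxA.
Qed.

Lemma lebesgue_zonotope_mulmx n (S : 'M[R]_n) : S \in unitmx ->
  exists2 c : R, 0 < c & forall m (T : 'M[R]_(m, n)),
    lebesgue_rV (zonotope q (T *m S)) = (c%:E * lebesgue_rV (zonotope q T))%E.
Proof.
move=> uS; have [c c0 cP] := @lebesgue_rV_mulmx R n (invmx S) (etrans (unitmx_inv S) uS).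
exists c => // m T; rewrite -cP ?zonotope_mulmxE; last exact: measurable_rV_zonotope.
congr lebesgue_rV; apply/seteqP; split => [_ [y yT <-]|y yT] /=.
  by rewrite mulmxK.
by exists (y *m invmx S); rewrite ?mulmxKV.
Qed.

Lemma symmetrization_bound_mulmx m n (T : 'M[R]_(m, n)) (S : 'M[R]_n) :
  S \in unitmx -> symmetrization_bound T -> symmetrization_bound (T *m S).
Proof.
move=> uS [le eqP]; have [c c0 cP] := lebesgue_zonotope_mulmx uS.
rewrite /symmetrization_bound -mulNmx -mul_col_mx !cP muleCA.
split; first by rewrite lee_pmul2l.
split => [/(mule_injl (z := c%:E))|[V VE]].
  rewrite fin_numE/= lte_fin => /(_ isT c0)/eqP[V VE].
  by exists (V *m S); exact: (zonotope_mulmx pq).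
congr (_ * _)%E; apply/eqP; exists (V *m invmx S).
by rewrite -(zonotope_mulmx pq _ VE) mulmxK.
Qed.

(** The hyperplane passes through 0 and contains the rows of T, since these are
    points of the zonotope. *)
Lemma hyperplane_zonotopeP m n (T : 'M[R]_(m, n)) :
  in_hyperplane (zonotope q T) <-> exists2 u : 'rV[R]_n, u != 0 & u *m T^T = 0.
Proof.
split => [[u [c [u0 uT]]]|[u u0 uT]]; exists u.
  exact: u0.
  have /= c0 : dot u 0 = c by apply: uT; exact: (zonotope0 pq).
  apply/rowP => i; rewrite [RHS]mxE.
  have /uT/= : zonotope q T (delta_mx 0 i *m T).
    exists (delta_mx 0 i) => //; have [p1 q1 _] := pq; split => [|j].
      rewrite /lq_ball/= (bigD1 i)//= big1 => [|j ji].
        by rewrite mxE !eqxx normr1 powR1 addr0.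
      by rewrite mxE (negbTE ji) andbF normr0 powR0// gt_eqF//; lra.
    by rewrite mxE; case: eqP => _; case: eqP.
  rewrite -c0 dot_mulmx [RHS]dotE trmx0 mulmx0 mxE => h.
  rewrite -[RHS]h /dot (bigD1 i)//= big1 ?addr0 => [|j ji].
    by rewrite [delta_mx _ _ _ _]mxE !eqxx mulr1.
  by rewrite [delta_mx _ _ _ _]mxE (negbTE ji) andbF mulr0.
exists 0; split => // _ [y _ <-] /=.
by rewrite dot_mulmx uT dotE mul0mx mxE.
Qed.

Lemma hyperplane_zonotope_null m n (T : 'M[R]_(m, n)) (u : 'rV[R]_n) :
  u != 0 -> u *m T^T = 0 -> lebesgue_rV (zonotope q T) = 0%E.
Proof.
move=> u0 uT; apply: (hyperplane_null (a := 0) u0); first exact: measurable_rV_zonotope.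
by move=> _ [y _ <-] /=; rewrite dot_mulmx uT dotE mul0mx mxE.
Qed.

Lemma frame_bound m n (E : {vspace 'rV[R]_m}) (T : 'M[R]_(m, n)) : frame E T ->
  let A := orth_proj E @` lq_ball q in
  let B := orth_proj E @` (lq_ball q `&` orthant) in
  ((lebesgue_vspace E A <= (2 ^+ n)%:E * lebesgue_vspace E B)%E /\
   (lebesgue_vspace E A = ((2 ^+ n)%:E * lebesgue_vspace E B)%E <->
    split_by_cones n E)) <-> symmetrization_bound T.
Proof.
move=> fT /=; rewrite !(frame_image _ fT) (lq_ball_zonotope pq) /symmetrization_bound.
have iff : split_by_cones n E <-> exists V : 'M[R]_n, zonotope q T = zonotope q V.
  split; first exact: (cones_zonotope_simplex pq).
  by move=> [V]; exact: (zonotope_simplex_cones pq).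
by split => -[le eqP]; split => //; rewrite eqP iff.
Qed.

(** In a hyperplane, both volumes are 0 and the equality case is satisfied. *)
Lemma zonotope_bound m n (T : 'M[R]_(m, n)) :
  let W := Lp_sum p (zonotope q T) (-%R @` zonotope q T) in
  ((lebesgue_rV W <= (2 ^+ n)%:E * lebesgue_rV (zonotope q T))%E /\
   (lebesgue_rV W = ((2 ^+ n)%:E * lebesgue_rV (zonotope q T))%E <->
    in_hyperplane (zonotope q T) \/
    exists v : 'I_n -> 'rV[R]_n,
      zonotope q T = Lp_bigsum p (fun i => segment 0 (v i)))) <->
  (in_hyperplane (zonotope q T) \/ symmetrization_bound T).
Proof.
rewrite /= zonotopeN (Lp_sum_zonotope pq).
have simplexE : (exists v : 'I_n -> 'rV[R]_n,
      zonotope q T = Lp_bigsum p (fun i => segment 0 (v i))) <->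
    exists V : 'M[R]_n, zonotope q T = zonotope q V.
  split => [[v ->]|[V ->]].
    by exists (\matrix_i v i); exact: (zonotope_Lp_bigsum pq).
  exists (fun i => row i V); rewrite (zonotope_Lp_bigsum pq); congr zonotope.
  by apply/matrixP => i j; rewrite !mxE.
rewrite simplexE; have [H|nH] := pselect (in_hyperplane (zonotope q T)).
  split => _; first by left.
  have [u u0 uT] := (hyperplane_zonotopeP T).1 H.
  have uT2 : u *m (col_mx T (- T))^T = 0.
    by rewrite tr_col_mx mul_mx_row linearN/= mulmxN uT oppr0 row_mx0.
  rewrite (hyperplane_zonotope_null u0 uT) (hyperplane_zonotope_null u0 uT2) mule0.
  by split => //; split => // _; left.
split => [[le eqP]|[//|[le eqP]]]; first right; split => //.
  by rewrite eqP; split => [[]|]; [|move=> ? |right].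
by rewrite eqP; split => [|[]]; [right| |].
Qed.

(** E is the span of the columns of T, and S = T'^T T gives their coordinates in the
    orthonormal basis T'. *)
Lemma factor_through_frame m n (T : 'M[R]_(m, n)) :
  (forall u : 'rV[R]_n, u *m T^T = 0 -> u = 0) ->
  exists (E : {vspace 'rV[R]_m}) (T' : 'M[R]_(m, n)) (S : 'M[R]_n),
    [/\ (n <= m)%N, \dim E = n, frame E T', S \in unitmx & T = T' *m S].
Proof.
move=> injT; pose X := [tuple row j T^T | j < n].
have freeX : free X.
  apply/freeP => k; under eq_bigr => i _ do rewrite -tnth_nth tnth_mktuple.
  move=> kX i; suff /rowP/(_ i) : \row_i k i = 0 by rewrite !mxE.
  by apply: injT; rewrite mulmx_sum_row -[RHS]kX; apply: eq_bigr => j _; rewrite mxE.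
have dE : \dim <<X>> = n by move: freeX; rewrite /free size_tuple => /eqP.
have [T' fT'] := frame_exists dE; have [TT _ ET _] := fT'.
have TE : T = T' *m (T'^T *m T).
  apply: trmx_inj; rewrite !trmx_mul trmxK; apply/row_matrixP => j.
  rewrite !row_mul; apply/esym/eqP; rewrite -ET memv_span//.
  by apply/mapP; exists j; rewrite ?mem_enum.
exists <<X>>%VS, T', (T'^T *m T); split => //.
  by rewrite -{1}dE; apply: leq_trans (dimvS (subvf _)) _; rewrite dimvf/= /dim/= mul1n.
rewrite -unitmx_tr; apply/negPn/negP => /non_unit_kernel[x x0 xS].
move: x0; rewrite (injT x) ?eqxx//.
by rewrite TE [X in _ *m X]trmx_mul mulmxA xS mul0mx.
Qed.

End SymmetrizationBound.

Theorem theorem13 (R : realType) (p q : R) (n : nat)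
    (hp : 1 < p) (hpq : 1 / p + 1 / q = 1) (hn : (1 <= n)%N) :
  (forall Z : set 'rV[R]_n, asymmetric_Lp_zonotope p Z ->
     let W := Lp_sum p Z (-%R @` Z) in
     (lebesgue_rV W <= (2 ^+ n)%:E * lebesgue_rV Z)%E /\
     (lebesgue_rV W = ((2 ^+ n)%:E * lebesgue_rV Z)%E <->
      in_hyperplane Z \/
      exists v : 'I_n -> 'rV[R]_n, Z = Lp_bigsum p (fun i => segment 0 (v i))))
  <->
  (forall (m : nat) (E : {vspace 'rV[R]_m}), (n <= m)%N -> \dim E = n ->
     let A := orth_proj E @` lq_ball q in
     let B := orth_proj E @` (lq_ball q `&` orthant) in
     (lebesgue_vspace E A <= (2 ^+ n)%:E * lebesgue_vspace E B)%E /\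
     (lebesgue_vspace E A = ((2 ^+ n)%:E * lebesgue_vspace E B)%E <->
      exists U : 'I_n.+1 -> {set 'I_m},
        [/\ partition_family U,
            forall j : 'I_n, U (lift ord0 j) != finset.set0,
            forall i : 'I_m, i \in U ord0 <-> orth_proj E (delta_mx 0 i) = 0 &
            exists w : 'I_n -> 'rV[R]_m,
              (forall j : 'I_n,
                 enorm (w j) = 1 /\ open_cone (U (lift ord0 j)) (w j)) /\
              E = <<[seq w j | j : 'I_n]>>%VS])).
Proof.
have pq := conjugate_exponentsP hp hpq.
split => [zonP m E _ dE|vsP Z].
  have [T fT] := frame_exists dE; apply/(frame_bound pq fT).
  have /zonotope_bound := zonP _ (zonotope_asymmetric pq T).
  move=> /(_ pq)[|//] /(hyperplane_zonotopeP pq)[u u0 uT].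
  have [TT _ _ _] := fT; move: u0; rewrite -[u]mulmx1 -TT mulmxA uT mul0mx.
  by rewrite eqxx.
move=> /(asymmetric_Lp_zonotopeE pq)[m [T ->]]; apply/(zonotope_bound pq).
have [[u u0 uT]|injT] := pselect (exists2 u : 'rV[R]_n, u != 0 & u *m T^T = 0).
  by left; apply/(hyperplane_zonotopeP pq); exists u.
right; have [u uT|E [T' [S [nm dE fT' uS ->]]]] := @factor_through_frame _ _ _ T _.
  by apply/eqP/negPn/negP => u0; apply: injT; exists u.
apply: (symmetrization_bound_mulmx pq uS); apply/(frame_bound pq fT').
exact: vsP.
Qed.
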